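(* Let $n\geqslant m\geqslant r\geqslant 3$ and $e\geqslant 2$ be integers, let $p$ be a prime, and fix an $m\times n$ matrix $\mathbf f=\(f_{i,j}(X_{i,j})\)_{1\leqslant i\leqslant m,\,1\leqslant j\leqslant n}$ of polynomials $f_{i,j}\in\mathbb{F}_p[X_{i,j}]$ with $2\leqslant \deg f_{i,j}\leqslant e$ for all $i,j$. Then for \[ H\leqslant p^{2/(e(e+1))} \] we have \[ L_{\mathbf f,r}(H,p)\leqslant H^{m+nr-r+\Gamma(m,n,r)+o(1)},\qquad \Gamma(m,n,r)=\max\{0,\ m-(n+r)/2,\ m(r-1)-n-r(r-2)\}, \] as $H\to\infty$.
   Context: For an integer $H\geqslant1$, $L_{\mathbf f,r}(H,p)$ denotes the number of tuples $(x_{i,j})_{1\leqslant i\leqslant m,\,1\leqslant j\leqslant n}$ of integers in $[-H,H]$ such that the matrix $\(f_{i,j}(x_{i,j} \bmod p)\)_{i,j}$ over the field $\mathbb{F}_p$ has rank exactly $r$. *)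

(* Defs.v *)
From HB Require Import structures.
From mathcomp Require Import all_boot all_order all_algebra.
From mathcomp Require Import reals exp.

Set Implicit Arguments.
Unset Strict Implicit.
Unset Printing Implicit Defensive.

Import Order.TTheory GRing.Theory Num.Theory.
Local Open Scope ring_scope.

(* The ordinals k < 2H + 1 enumerate the integers of [-H, H] by k |-> k - H. *)
Definition box_int (H : nat) (k : 'I_(2 * H).+1) : int := k%:Z - H%:Z.

Lemma box_int_inj (H : nat) : injective (@box_int H).
Proof. by move=> i j /addIr [] /val_inj. Qed.

Lemma box_int_image (H : nat) (z : int) :
  (- H%:Z <= z <= H%:Z) <-> exists k : 'I_(2 * H).+1, box_int k = z.
Proof.
split=> [/andP[lez gez]|[k <-]]; last first.
  rewrite /box_int lerBrDr addNr lerBlDr -PoszD !lez_nat /=.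
  by rewrite addnn -mul2n -ltnS ltn_ord.
have : 0 <= z + H%:Z by rewrite -lerBlDr sub0r.
case E: (z + H%:Z) => [k|//] _.
have ltk : (k < (2 * H).+1)%N.
  by rewrite ltnS -lez_nat -E mul2n -addnn PoszD lerD2r.
by exists (Ordinal ltk); rewrite /box_int /= -E addrK.
Qed.

(* L_{f,r}(H,p); 'F_p is the field with p elements when p is prime. *)
Definition rank_count (p m n : nat) (f : 'M[{poly 'F_p}]_(m, n))
    (r H : nat) : nat :=
  #|[set x : 'M['I_(2 * H).+1]_(m, n) |
      \rank (\matrix_(i, j) (f i j).[(box_int (x i j))%:~R]) == r]|.

Definition Gamma (R : realType) (m n r : nat) : R :=
  Num.max 0 (Num.max (m%:R - (n%:R + r%:R) / 2)
                     (m%:R * (r%:R - 1) - n%:R - r%:R * (r%:R - 2))).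

(* Main.v *)
(** Replace each entry by its value: since the polynomials are at most e-to-one,
    it suffices to count matrices with entries in sets V_ij of at most 2H + 1
    elements. A matrix of rank r has an invertible r x r block, and each of its
    rows is a combination of the r rows I of the block. Let t be the largest
    number of rows I that such a combination needs. Inside the r columns of the
    block, each of the m - r other rows then has at most about H^t choices. Each
    of the n - r other columns is determined by its entries in the rows I, which
    gives H^r choices; if t = 2 or t >= 3, these entries also satisfy a
    linear equation with three or at least four terms, and an additive energy
    of H^(2+o(1)) lowers the count to H^(r-1/2+o(1)) or H^(r-1+o(1)). The cases
    t = 1, t = 2 and t >= 3 yield the three terms of Gamma.

    For the energy of g, the equation g(x1) + g(x2) = g(x3) + g(x4) is linear in
    the power sum differences s_k = x1^k + x2^k - x3^k - x4^k, and the
    assumption on H makes determinants of such vectors smaller than p. So the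
    s_k satisfy an integer linear relation, that is, F(x1) + F(x2) =
    F(x3) + F(x4) over the integers for a fixed polynomial F. If F has degree at
    least 2, then x1 - x3 divides F(x4) - F(x2) and the divisor bound applies;
    if F is linear, the original equation becomes
    g(x3 + c) - g(x3) = g(x2 + c) - g(x2) with c = x1 - x3. *)

Require Import Defs.
From HB Require Import structures.
From mathcomp Require Import all_boot all_order all_algebra.
From mathcomp Require Import perm zify ring lra.
From mathcomp Require Import reals exp.

Set Implicit Arguments.
Unset Strict Implicit.
Unset Printing Implicit Defensive.

Import Order.TTheory GRing.Theory Num.Theory.
Local Open Scope ring_scope.

(** * Counting by injections, images and fibres *)

Lemma leq_exp2rW (m n k : nat) : (m <= n)%N -> (m ^ k <= n ^ k)%N.
Proof. by move=> mn; elim: k => // k IHk; rewrite !expnS leq_mul. Qed.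

Lemma leq_card_inj_in (T U : finType) (S : {set T}) (S' : {set U}) (h : T -> U) :
  {in S, forall x, h x \in S'} -> {in S &, injective h} -> (#|S| <= #|S'|)%N.
Proof.
move=> hS h_inj; rewrite -(card_in_imset h_inj); apply: subset_leq_card.
by apply/subsetP=> _ /imsetP[x xS ->]; apply: hS.
Qed.

Lemma leq_card_preim_in (T U : finType) (S : {set T}) (S' : {set U}) (h : U -> T) :
  {in S, forall x, exists2 y, y \in S' & x = h y} -> (#|S| <= #|S'|)%N.
Proof.
move=> hS; apply: leq_trans (leq_imset_card h S'); apply: subset_leq_card.
by apply/subsetP=> x /hS[y yS' ->]; apply: imset_f.
Qed.

Lemma leq_card_fibers (T U : finType) (S : {set T}) (S' : {set U}) (h : T -> U)
    (k : nat) :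
  {in S, forall x, h x \in S'} ->
  (forall y, y \in S' -> (#|[set x in S | h x == y]| <= k)%N) ->
  (#|S| <= #|S'| * k)%N.
Proof.
move=> hS hk; rewrite -sum1_card (partition_big h (mem S')) //=.
rewrite -sum_nat_const; apply: leq_sum => y /hk; apply: leq_trans.
by rewrite -sum1dep_card.
Qed.

(** * The divisor bound *)

Lemma bin_le_exp2 (n k : nat) : ('C(n, k) <= 2 ^ n)%N.
Proof.
elim: n k => [|n IHn] [|k]; rewrite ?bin0 ?expn_gt0 //.
by rewrite binS expnS mul2n -addnn leq_add.
Qed.

(** The product (a + 1)...(a + k) equals k! C(a + k, k), and the binomial coefficient is at most
    2^(a + k). *)
Lemma expn_le_factM2 (k a : nat) : (a.+1 ^ k <= k`! * 2 ^ k * 2 ^ a)%N.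
Proof.
have Hb : (a.+1 ^ k <= k`! * 'C(a + k, k))%N.
  elim: k => [|k IHk]; first by rewrite bin0.
  have /= e := mul_bin_diag (a + k.+1) k.
  rewrite factS -mulnA mulnCA -e mulnCA addnS /= expnS.
  by apply: leq_mul => //; rewrite ltnS leq_addr.
by apply: leq_trans Hb _; rewrite -mulnA leq_mul2l -expnD addnC bin_le_exp2 orbT.
Qed.

(** A divisor of p^a m is determined by its exponent of p and its p'-part, which divides m. *)
Lemma size_divisors_pM (p a m : nat) : prime p -> (0 < m)%N -> ~~ (p %| m)%N ->
  (size (divisors (p ^ a * m)) <= a.+1 * size (divisors m))%N.
Proof.
move=> pp m_gt0 pNm; have pa_gt0 : (0 < p ^ a)%N by rewrite expn_gt0 prime_gt0.
have n_gt0 : (0 < p ^ a * m)%N by rewrite muln_gt0 pa_gt0.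
have -> : (a.+1 * size (divisors m) =
    size [seq (p ^ i * d)%N | i <- iota 0 a.+1, d <- divisors m])%N.
  by rewrite size_allpairs size_iota.
apply: uniq_leq_size (divisors_uniq _) _ => d; rewrite -dvdn_divisors // => dn.
have d_gt0 := dvdn_gt0 n_gt0 dn.
apply/allpairsP; exists (logn p d, d`_p^')%N; split.
- rewrite mem_iota [_.1]/= add0n ltnS.
  apply: leq_trans (dvdn_leq_log p n_gt0 dn) _.
  by rewrite lognM // pfactorK // lognE pp m_gt0 (negPf pNm) addn0.
- rewrite [_.2]/= -dvdn_divisors //; have := partn_dvd p^' n_gt0 dn.
  rewrite partnM // partnX (_ : p`_p^' = 1)%N; last first.
    by apply: part_p'nat; rewrite pnatNK pnat_id.
  by rewrite exp1n mul1n (@part_pnat_id p^' m) // p'natE.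
- by rewrite /= -p_part partnC.
Qed.

(* Primes above 2^k contribute a factor at most 1 to tau(n)^k / n, since
   (a + 1)^k <= 2^(k a) <= p^a; each of the finitely many smaller primes
   contributes a bounded factor. *)
Lemma divisor_bound_aux (k : nat) (s : seq nat) (n : nat) : (0 < n)%N ->
  {subset primes n <= s} ->
  (size (divisors n) ^ k <=
     (k`! * 2 ^ k) ^ (count (fun p => p < 2 ^ k)%N s) * n)%N.
Proof.
set c := (k`! * 2 ^ k)%N.
elim: s n => [|p s IHs] n n_gt0 sub.
  have n1 : n = 1%N.
    apply/eqP; move: n_gt0; case: n sub => [|[|n]] // sub _.
    by have := sub (pdiv n.+2); rewrite mem_primes pdiv_prime // pdiv_dvd => /(_ isT).
  by rewrite n1 expn0 muln1 /= exp1n.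
have c_gt0 : (0 < c)%N by rewrite muln_gt0 fact_gt0 expn_gt0.
have [pp|npp] := boolP (prime p); last first.
  have /(IHs n n_gt0) H : {subset primes n <= s}.
    move=> q qn; have := sub q qn; rewrite in_cons => /orP[/eqP eqp|//].
    by move: qn; rewrite eqp mem_primes (negPf npp).
  apply: leq_trans H _; rewrite leq_mul2r leq_pexp2l ?orbT //.
  by rewrite /= leq_addl.
have m_gt0 : (0 < n`_p^')%N by exact: part_gt0.
have pNm : ~~ (p %| n`_p^')%N by rewrite -p'natE // part_pnat.
have En : (n = p ^ logn p n * n`_p^')%N by rewrite -p_part partnC.
have subm : {subset primes n`_p^' <= s}.
  move=> q; rewrite mem_primes => /and3P[pq _ qm].
  have : q \in p :: s.
    by apply: sub; rewrite mem_primes pq n_gt0 En dvdn_mull.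
  by rewrite in_cons => /orP[/eqP eqp|//]; move: pNm qm; rewrite eqp => /negPf ->.
have := IHs _ m_gt0 subm; set m := (n`_p^')%N in m_gt0 pNm En subm *.
set a := logn p n in En; rewrite [in X in _ -> X]En => IH.
apply: (@leq_trans (a.+1 ^ k * size (divisors m) ^ k)%N).
  by rewrite -expnMn leq_exp2rW // size_divisors_pM.
have step : (a.+1 ^ k <= c ^ (p < 2 ^ k) * p ^ a)%N.
  have [pk|kp] := ltnP p (2 ^ k)%N.
    rewrite expn1; apply: leq_trans (expn_le_factM2 k a) _.
    by rewrite leq_mul2l leq_exp2rW ?orbT // prime_gt1.
  rewrite expn0 mul1n; apply: (@leq_trans ((2 ^ k) ^ a)%N).
    by rewrite -expnM mulnC expnM leq_exp2rW // ltn_expl.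
  by rewrite leq_exp2rW.
apply: leq_trans (leq_mul step IH) _.
by rewrite /= expnD mulnACA.
Qed.

(** This is tau(n) = n^(o(1)) over the naturals: k is arbitrary and C depends only on k. At most 2^k
    primes lie below 2^k, which makes the constant uniform in n. *)
Lemma divisor_bound (k : nat) : exists2 C : nat, (0 < C)%N &
  forall n : nat, (0 < n)%N -> (size (divisors n) ^ k <= C * n)%N.
Proof.
have c_gt0 : (0 < k`! * 2 ^ k)%N by rewrite muln_gt0 fact_gt0 expn_gt0.
exists ((k`! * 2 ^ k) ^ (2 ^ k))%N => [|n n_gt0]; first by rewrite expn_gt0 c_gt0.
apply: leq_trans (divisor_bound_aux k n_gt0 (s := primes n) _) _ => //.
rewrite leq_mul2r leq_pexp2l ?orbT // -size_filter.
rewrite -[X in (_ <= X)%N](size_iota 0); apply: uniq_leq_size.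
  by rewrite filter_uniq ?primes_uniq.
by move=> p; rewrite mem_filter mem_iota => /andP[-> _].
Qed.

(** * Additive energy and linear equations *)

Definition coincidences (A B : finType) (V : eqType) (f : A -> V) (g : B -> V) :=
  #|[set x : A * B | f x.1 == g x.2]|.

(** Quadruples of arguments are counted, not of values, so a value taken several times counts with
    multiplicity. *)
Definition energy (X : finType) (V : zmodType) (g : X -> V) : nat :=
  let s (x : X * X) := g x.1 + g x.2 in coincidences s s.

Lemma sum_Cauchy_Schwarz (I : finType) (a b : I -> nat) :
  ((\sum_i a i * b i) ^ 2 <= (\sum_i a i ^ 2) * (\sum_i b i ^ 2))%N.
Proof.
rewrite -(leq_pmul2l (isT : (0 < 2)%N)) -mulnn !big_distrlr /=.
rewrite [X in (_ <= X)%N]mulSn mul1n [X in (_ <= _ + X)%N]exchange_big /=.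
rewrite -big_split big_distrr /=; apply: leq_sum => i _.
rewrite -big_split big_distrr /=; apply: leq_sum => j _.
have := nat_Cauchy (a i * b j) (a j * b i).
by rewrite !expnMn mulnACA [(b j * _)%N]mulnC mulnACA => -[].
Qed.

(** The right side is an inner product of fibre sizes, ready for Cauchy-Schwarz. *)
Lemma coincidencesE (A B V : finType) (f : A -> V) (g : B -> V) :
  coincidences f g =
    (\sum_v #|[set a | f a == v]| * #|[set b | g b == v]|)%N.
Proof.
rewrite /coincidences -sum1dep_card.
rewrite (partition_big (fun x : A * B => f x.1) xpredT) //=.
apply: eq_bigr => v _; rewrite -cardsX -sum1_card.
apply: eq_bigl => x; rewrite !inE /=.
by case: (f x.1 =P v) => [->|_]; rewrite ?andbF ?andbT // eq_sym.
Qed.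

Lemma coincidences_CS (A B V : finType) (f : A -> V) (g : B -> V) :
  (coincidences f g ^ 2 <= coincidences f f * coincidences g g)%N.
Proof. by rewrite !coincidencesE; apply: sum_Cauchy_Schwarz. Qed.

Section Energy.
Variable F : finFieldType.

Lemma energy_affine (X : finType) (g : X -> F) (a b : F) : a != 0 ->
  energy (fun x => a * g x + b) = energy g.
Proof.
move=> a0; apply: eq_card => x; rewrite !inE.
rewrite !(addrACA _ b) -!mulrDr (inj_eq (addIr _)).
by rewrite (inj_eq (mulfI a0)).
Qed.

Lemma coincidences_sub_energy (X : finType) (g : X -> F) :
  (coincidences (fun x : X * X => g x.1 - g x.2)%R
     (fun x : X * X => g x.1 - g x.2)%R <= energy g)%N.
Proof.
apply: (leq_card_inj_in (h := fun x => ((x.1.1, x.2.2), (x.2.1, x.1.2)))).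
  move=> [[x x'] [z z']]; rewrite !inE /= => /eqP e; apply/eqP.
  by rewrite -[g x](subrK (g x')) e; ring.
by move=> [[x x'] [z z']] [[y y'] [t t']] _ _ /= [-> -> -> ->].
Qed.

(** Rewritten as f x - f x' = g y' - g y, the equation is a coincidence of two difference maps;
    Cauchy-Schwarz then separates f from g. *)
Lemma coincidences_sum2 (X Y : finType) (f : X -> F) (g : Y -> F) (E : nat) :
  (energy f <= E)%N -> (energy g <= E)%N ->
  (coincidences (fun x : X * Y => f x.1 + g x.2)%R
     (fun x : X * Y => f x.1 + g x.2)%R <= E)%N.
Proof.
move=> fE gE; set s := fun x => _.
pose df (x : X * X) := f x.1 - f x.2; pose dg (y : Y * Y) := g y.1 - g y.2.
have le1 : (coincidences s s <= coincidences df dg)%N.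
  apply: (leq_card_inj_in (h := fun x => ((x.1.1, x.2.1), (x.2.2, x.1.2)))).
    move=> [[x y] [x' y']]; rewrite !inE /= /s /df /dg /= => /eqP e; apply/eqP.
    by rewrite -[f x](addrK (g y)) e; ring.
  by move=> [[x x'] [z z']] [[y y'] [t t']] _ _ /= [-> -> -> ->].
apply: leq_trans le1 _; rewrite -leq_sqr.
apply: leq_trans (coincidences_CS _ _) _; rewrite -mulnn; apply: leq_mul.
  exact: leq_trans (coincidences_sub_energy f) fE.
exact: leq_trans (coincidences_sub_energy g) gE.
Qed.

Lemma coincidences_sum4 (X Y Z T : finType) (f : X -> F) (g : Y -> F)
    (h : Z -> F) (k : T -> F) (E : nat) :
  (energy f <= E)%N -> (energy g <= E)%N ->
  (energy h <= E)%N -> (energy k <= E)%N ->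
  (coincidences (fun x : X * Y => f x.1 + g x.2)%R
                (fun x : Z * T => h x.1 + k x.2)%R <= E)%N.
Proof.
move=> fE gE hE kE; rewrite -leq_sqr.
apply: leq_trans (coincidences_CS _ _) _.
by rewrite -mulnn; apply: leq_mul; apply: coincidences_sum2.
Qed.

Lemma coincidences_sum3 (X Y Z : finType) (f : X -> F) (g : Y -> F)
    (h : Z -> F) (E : nat) :
  (energy g <= E)%N -> (energy h <= E)%N ->
  (coincidences f (fun x : Y * Z => g x.1 + h x.2)%R ^ 2 <=
     coincidences f f * E)%N.
Proof.
move=> gE hE; apply: leq_trans (coincidences_CS _ _) _.
by rewrite leq_mul2l coincidences_sum2 ?orbT.
Qed.

Lemma coincidences_self_le (X : finType) (V : eqType) (f : X -> V) (k : nat) :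
  (forall v, #|[set x | f x == v]| <= k)%N -> (coincidences f f <= #|X| * k)%N.
Proof.
move=> fk; rewrite -cardsT.
apply: (leq_card_fibers (h := fst)) => [x _ | x _]; first by rewrite inE.
apply: leq_trans (fk (f x)).
apply: (leq_card_inj_in (h := snd)) => [[y z]|[y z] [y' z']].
  by rewrite !inE /= => /andP[/eqP e /eqP<-]; rewrite e.
by rewrite !inE /= => /andP[_ /eqP->] /andP[_ /eqP->] ->.
Qed.

(** Cauchy-Schwarz leaves the diagonal count |X| k for the lone term and an energy for the other
    two. With |X| about H and E = H^(2+o(1)), the count is H^(3/2+o(1)). *)
Lemma linear_equation3_count (X Y Z : finType) (f : X -> F) (g : Y -> F)
    (h : Z -> F) (k E : nat) (a b c : F) :
  (forall v, #|[set x | f x == v]| <= k)%N ->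
  (energy g <= E)%N -> (energy h <= E)%N -> a != 0 -> b != 0 ->
  (#|[set x : X * (Y * Z) | f x.1 == a * g x.2.1 + b * h x.2.2 + c]%R| ^ 2 <=
     #|X| * k * E)%N.
Proof.
move=> fk gE hE a0 b0; set S := [set x | _].
pose g' y := a * g y + c; pose h' z := b * h z + 0.
have -> : #|S| = coincidences f (fun x : Y * Z => g' x.1 + h' x.2).
  by apply: eq_card => x; rewrite !inE /g' /h' addr0 addrAC.
apply: leq_trans (coincidences_sum3 (E := E) _ _ _) _.
- by rewrite energy_affine.
- by rewrite energy_affine.
by rewrite leq_mul2r coincidences_self_le ?orbT.
Qed.

Lemma linear_equation4_count (X Y Z T : finType) (f : X -> F) (g : Y -> F)
    (h : Z -> F) (l : T -> F) (E : nat) (a b c d : F) :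
  (energy f <= E)%N -> (energy g <= E)%N ->
  (energy h <= E)%N -> (energy l <= E)%N -> a != 0 -> b != 0 -> c != 0 ->
  (#|[set x : X * (Y * (Z * T)) |
       f x.1 == a * g x.2.1 + b * h x.2.2.1 + c * l x.2.2.2 + d]%R| <= E)%N.
Proof.
move=> fE gE hE lE a0 b0 c0; set S := [set x | _].
(* The coefficients and the constant [d] are absorbed into affine maps, which leave the energy
   unchanged. *)
pose f' x := 1 * f x + - d; pose g' y := - a * g y + 0.
pose h' z := b * h z + 0; pose l' t := c * l t + 0.
have : (coincidences (fun x : X * Y => f' x.1 + g' x.2)%R
    (fun x : Z * T => h' x.1 + l' x.2)%R <= E)%N.
  by apply: coincidences_sum4; rewrite energy_affine // ?oppr_eq0 ?oner_neq0.
apply: leq_trans.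
apply: (leq_card_inj_in (h := fun x => ((x.1, x.2.1), (x.2.2.1, x.2.2.2)))).
  move=> [x [y [z t]]]; rewrite !inE /f' /g' /h' /l' /= => /eqP->; apply/eqP; ring.
by move=> [x [y [z t]]] [x' [y' [z' t']]] _ _ /= [-> -> -> ->].
Qed.

End Energy.

(** * Integer relations and energy of polynomials *)

(** Each permutation in the Leibniz expansion takes exactly one entry from each column. *)
Lemma norm_det_le (d : nat) (M : 'M[int]_d) (c : 'I_d -> int) :
  (forall i j, `|M i j| <= c j) -> `|\det M| <= d`!%:Z * \prod_j c j.
Proof.
move=> Mc; apply: le_trans (ler_norm_sum _ _ _) _.
have -> : d`!%:Z * \prod_j c j = \sum_(s : 'S_d) \prod_j c j.
  by rewrite sumr_const card_Sn -natz mulr_natl.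
apply: ler_sum => s _; rewrite normrMsign normr_prod.
rewrite [leRHS](reindex_inj (@perm_inj _ s)) /=.
by apply: ler_prod => i _; rewrite normr_ge0 Mc.
Qed.

(* Among the d-tuples of vectors s t and unit vectors that have nonzero
   determinant, one with the fewest unit vectors either has none, or the
   cofactors along one of its unit rows give the linear relation b. *)
Lemma det_neq0_or_relation (d : nat) (T : finType) (s : T -> 'I_d -> int)
    (B : int) :
  1 <= B -> (forall t k, `|s t k| <= B) ->
  (exists w : 'I_d -> T, \det (\matrix_(i, k) s (w i) k) != 0) \/
  (exists b : 'I_d -> int, [/\ exists k, b k != 0,
     forall k, `|b k| <= d`!%:Z * B ^+ d &
     forall t, \sum_k s t k * b k = 0]).
Proof.
move=> B1 sB.
pose vec (u : T + 'I_d) k : int :=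
  match u with inl t => s t k | inr j => (j == k)%:R end.
pose mat (u : {ffun 'I_d -> T + 'I_d}) := \matrix_(i, k) vec (u i) k.
pose isl (u : T + 'I_d) := if u is inl _ then true else false.
have P0 : \det (mat [ffun i => inr i]) != 0.
  rewrite (_ : mat _ = 1%:M) ?det1 ?oner_neq0 //.
  by apply/matrixP => i j; rewrite !mxE ffunE.
case: (arg_maxnP (P := fun u => \det (mat u) != 0)
  (fun u : {ffun 'I_d -> T + 'I_d} => #|[set i | isl (u i)]|) P0) => u Pu umax.
have [/forallP uT|] := boolP [forall i, isl (u i)].
  left; have ex i : exists t, u i = inl t.
    by have := uT i; case: (u i) => // t _; exists t.
  (* If [T] is empty then [d] is 0, since every row index yields an element of [T]. *)
  have [t0 _|no] := pickP (fun _ : T => true); last first.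
    have d0 : forall i : 'I_d, False by move=> i; have [t _] := ex i; have := no t.
    exists (fun i => False_rect T (d0 i)).
    rewrite (_ : \matrix_(i, k) _ = mat u) //.
    by apply/matrixP => i; case: (d0 i).
  exists (fun i => if u i is inl t then t else t0).
  rewrite (_ : \matrix_(i, k) _ = mat u) //.
  by apply/matrixP => i k; rewrite !mxE; have [t ->] := ex i.
rewrite negb_forall => /existsP[i0 ui0]; right.
exists (cofactor (mat u) i0); split.
- apply/existsP; apply: contraNT Pu; rewrite negb_exists => /forallP b0.
  rewrite (expand_det_row _ i0) big1 // => k _.
  by have := b0 k; rewrite negbK => /eqP->; rewrite mulr0.
- move=> k; rewrite /cofactor normrMsign.
  apply: le_trans (@norm_det_le _ _ (fun _ => B) _) _ => [i j|].
    rewrite !mxE /vec; case: (u _) => // j'.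
    by case: eqP => _ /=; rewrite ?normr0 ?normr1 // (le_trans ler01).
  rewrite prodr_const card_ord; apply: ler_pM => //.
  + by rewrite exprn_ge0 // (le_trans ler01).
  + by rewrite lez_nat leq_fact ?leq_pred.
  + by apply: ler_weXn2l => //; rewrite leq_pred.
- move=> t; pose u' : {ffun 'I_d -> T + 'I_d} :=
    [ffun i => if i == i0 then inl t else u i].
  have -> : \sum_k s t k * cofactor (mat u) i0 k = \det (mat u').
    rewrite (expand_det_row _ i0); apply: eq_bigr => k _.
    rewrite [in RHS]mxE ffunE eqxx /=; congr (_ * (_ * \det _)).
    by apply/matrixP => i j; rewrite !mxE ffunE eq_sym (negPf (neq_lift _ _)).
  (* Putting [s t] in place of the unit row [i0] leaves fewer unit rows, so by maximality the new
     determinant vanishes. *)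
  apply/eqP; apply: contraT => /umax; rewrite /= leqNgt; case/negP.
  apply: proper_card; apply/properP; split.
    apply/subsetP=> i; rewrite !inE ffunE; case: eqP => // _ _; exact: isT.
  by exists i0; rewrite !inE ?ffunE ?eqxx.
Qed.

(** * Roots of polynomials and of their differences *)

Section Roots.
Variables (R : idomainType) (X : finType) (iota : X -> R).
Hypothesis iota_inj : injective iota.

Lemma card_roots_le (P : {poly R}) : P != 0 ->
  (#|[set x | P.[iota x] == 0]%R| <= (size P).-1)%N.
Proof.
move=> P0; rewrite -ltnS prednK ?lt0n ?size_poly_eq0 //.
rewrite cardE -(size_map iota); apply: max_poly_roots => //.
  by apply/allP => _ /mapP[x xP ->]; move: xP; rewrite mem_enum inE.
by rewrite map_inj_uniq // enum_uniq.
Qed.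

Lemma card_fiber_poly_le (P : {poly R}) (v : R) : (1 < size P)%N ->
  (#|[set x | P.[iota x] == v]%R| <= (size P).-1)%N.
Proof.
move=> P1; have sz : size (P - v%:P) = size P.
  rewrite size_polyDl // size_polyN (leq_ltn_trans _ P1) //.
  by rewrite size_polyC leq_b1.
rewrite -sz; have -> : [set x | P.[iota x] == v] =
    [set x | (P - v%:P).[iota x] == 0].
  by apply/setP=> x; rewrite !inE !hornerE subr_eq0.
by apply: card_roots_le; rewrite -size_poly_gt0 sz ltnW.
Qed.

Lemma coef_XaddC_exp_pred (c : R) (k : nat) :
  ((('X + c%:P) ^+ k.+1)`_k = c *+ k.+1).
Proof.
elim: k => [|k IHk]; first by rewrite expr1 coefD coefX coefC add0r.
have szk : size (('X + c%:P) ^+ k.+1) = k.+2.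
  by rewrite -(opprK c) polyCN size_exp_XsubC.
rewrite exprSr mulrDr coefD coefMX /= IHk coefMC [RHS]mulrSr; congr (_ + _).
have /monicP := monic_exp k.+1 (monicXaddC c).
by rewrite lead_coefE szk /= => ->; rewrite mul1r.
Qed.

(** The coefficient of X^(deg P - 1) in P(X + c) - P is deg P times c times the leading coefficient
    of P. As deg P >= 2, subtracting [v] does not touch it. *)
Lemma shift_sub_neq0 (P : {poly R}) (c v : R) : (2 < size P)%N ->
  ((size P).-1)%:R != 0 :> R -> c != 0 -> P \Po ('X + c%:P) - P - v%:P != 0.
Proof.
case E: (size P) => [|[|[|k]]] //= _ k0 c0.
apply/eqP => /polyP/(_ k.+1)/eqP; apply/negP.
rewrite coef0 !coefB coefC subr0 coef_comp_poly E 2!big_ord_recr /=.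
have szk j : size (('X + c%:P) ^+ j) = j.+1.
  by rewrite -(opprK c) polyCN size_exp_XsubC.
rewrite big1 ?add0r => [|i _]; last first.
  by rewrite [X in _ * X]nth_default ?mulr0 // szk.
have /monicP := monic_exp k.+1 (monicXaddC c).
rewrite lead_coefE szk /= => ->; rewrite mulr1 addrAC subrr add0r.
rewrite coef_XaddC_exp_pred -mulr_natr !mulf_neq0 //.
by have := lead_coef_eq0 P; rewrite lead_coefE E /= -size_poly_eq0 E => ->.
Qed.

Lemma card_shift_eq_le (P : {poly R}) (c v : R) : (2 < size P)%N ->
  ((size P).-1)%:R != 0 :> R -> c != 0 ->
  (#|[set x | P.[iota x + c] - P.[iota x] == v]%R| <= size P)%N.
Proof.
move=> P2 k0 c0; set Q := P \Po ('X + c%:P) - P - v%:P.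
have szQ : (size Q <= size P)%N.
  rewrite (leq_trans (size_polyD _ _)) // size_polyN geq_max; apply/andP; split; last first.
    by rewrite size_polyC; apply: leq_trans (leq_b1 _) (ltnW (ltnW P2)).
  rewrite (leq_trans (size_polyD _ _)) // size_polyN geq_max leqnn andbT.
  by rewrite size_comp_poly2 // size_XaddC.
have -> : [set x | P.[iota x + c] - P.[iota x] == v] =
    [set x | Q.[iota x] == 0].
  by apply/setP=> x; rewrite !inE !hornerE horner_comp !hornerE subr_eq0.
apply: leq_trans (card_roots_le (shift_sub_neq0 _ P2 k0 c0)) _.
by rewrite (leq_trans (leq_pred _)).
Qed.

End Roots.

Lemma horner_sub_dvd (R : comNzRingType) (P : {poly R}) (x y : R) :
  exists q, P.[x] - P.[y] = q * (x - y).
Proof.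
have /factor_theorem[q E] : root (P - P.[y]%:P) y by rewrite /root !hornerE subrr.
exists q.[x]; have := congr1 (horner^~ x) E.
by rewrite /= !hornerE.
Qed.

Lemma card_horner_sub_eq (h : nat) (P : {poly int}) (N : int) :
  (2 < size P)%N -> N != 0 ->
  (#|[set z : 'I_h.+1 * 'I_h.+1 | P.[z.1%:Z] - P.[z.2%:Z] == N]%R| <=
     size (divisors `|N|) * 2 * size P)%N.
Proof.
move=> P2 N0.
pose S' := setX [set a : 'I_h.+1 | (a : nat) \in divisors `|N|] [set: bool].
have cS' : (#|S'| <= size (divisors `|N|) * 2)%N.
  rewrite cardsX cardsT card_bool leq_mul2r /= cardE -(size_map val).
  apply: uniq_leq_size; first by rewrite map_inj_uniq ?enum_uniq //; apply: val_inj.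
  by move=> _ /mapP[x xP ->]; move: xP; rewrite mem_enum inE.
apply: leq_trans (leq_mul cS' (leqnn _)).
have Ngt0 : (0 < `|N|)%N by rewrite absz_gt0.
(* With truncated subtraction one of the two terms is zero, so the sum is |x - y|, a divisor of N;
   the boolean records the sign. *)
pose dist (z : 'I_h.+1 * 'I_h.+1) : 'I_h.+1 * bool :=
  (inord ((z.1 - z.2) + (z.2 - z.1))%N, (z.1 < z.2)%N).
apply: (leq_card_fibers (h := dist)) => [[x y]|[a b]].
  rewrite !inE /= => /eqP e; rewrite andbT inordK; last first.
    by have := ltn_ord x; have := ltn_ord y; lia.
  rewrite -dvdn_divisors //; have [q] := horner_sub_dvd P x%:Z y%:Z.
  rewrite e => ->; rewrite abszM (_ : absz (x%:Z - y%:Z) = x - y + (y - x))%N.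
    exact: dvdn_mull.
  lia.
rewrite !inE /= andbT -dvdn_divisors // => aN.
have a_gt0 := dvdn_gt0 Ngt0 aN.
pose c : int := if b then - a%:Z else a%:Z.
have c0 : c != 0 by rewrite /c; case: (b); lia.
have iota_inj : injective (fun x : 'I_h.+1 => x%:Z) by move=> x y [] /val_inj.
have n0 : ((size P).-1)%:R != 0 :> int by rewrite pnatr_eq0; lia.
apply: leq_trans (card_shift_eq_le iota_inj N P2 n0 c0).
have Hc z : dist z = (a, b) -> z.1%:Z = z.2%:Z + c.
  rewrite /c; case: z => x y /= [/(congr1 val)/=]; rewrite inordK => [<-|]; last first.
    by have := ltn_ord x; have := ltn_ord y; lia.
  by move=> <-; case: ltnP; lia.
apply: (leq_card_inj_in (h := snd)) => [z|z z'].
  by rewrite !inE => /andP[/eqP <- /eqP/Hc ->].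
rewrite !inE => /andP[_ /eqP/Hc e] /andP[_ /eqP/Hc e'] ez.
have e1 : z.1 = z'.1 by apply: iota_inj => /=; rewrite e e' ez.
by move: z z' ez e1 {e e'} => [x y] [x' y'] /= -> ->.
Qed.

(* For a nonzero value N = P(d) - P(c), the equation P(x) - P(y) = N forces
   x - y to divide N, and then leaves boundedly many x. *)
Lemma energy_int_poly_le (h D : nat) (P : {poly int}) : (2 < size P)%N ->
  (forall x y : 'I_h.+1, P.[x%:Z] - P.[y%:Z] != 0 ->
    (size (divisors `|P.[x%:Z] - P.[y%:Z]|) <= D)%N) ->
  (energy (fun x : 'I_h.+1 => P.[x%:Z]) <=
     h.+1 ^ 2 * (size P ^ 2 + D * 2 * size P))%N.
Proof.
move=> P2 hD; rewrite /energy /coincidences; set S := [set x | _].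
have iota_inj : injective (fun x : 'I_h.+1 => x%:Z) by move=> x y [] /val_inj.
(* [B] is the degenerate part: P(x2) = P(x4) forces P(x1) = P(x3), and both pairs lie in small
   fibres. Outside [B], x2 and x4 are fixed and N is nonzero. *)
pose B := [set x : ('I_h.+1 * 'I_h.+1) * ('I_h.+1 * 'I_h.+1) |
  P.[x.1.2%:Z] == P.[x.2.2%:Z]].
rewrite -(cardsID B S) mulnDr; apply: leq_add.
  pose K := [set x : 'I_h.+1 * 'I_h.+1 | P.[x.1%:Z] == P.[x.2%:Z]].
  have cK : (#|K| <= h.+1 * size P)%N.
    rewrite -[h.+1 in leqRHS]card_ord.
    apply: (coincidences_self_le (f := fun x : 'I_h.+1 => P.[x%:Z])) => v.
    apply: leq_trans (card_fiber_poly_le iota_inj v (ltnW P2)) _.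
    exact: leq_pred.
  apply: leq_trans (_ : #|setX K K| <= _)%N; last first.
    by rewrite cardsX -expnMn -mulnn leq_mul.
  apply: (leq_card_inj_in (h := fun x => ((x.1.1, x.2.1), (x.1.2, x.2.2)))).
    move=> [[x y] [x' y']]; rewrite !inE /= => /andP[/eqP e /eqP e'].
    by rewrite e' eqxx andbT; move: e; rewrite e' => /addIr->.
  by move=> [[x x'] [z z']] [[y y'] [t t']] _ _ /= [-> -> -> ->].
have -> : (h.+1 ^ 2 = #|[set: 'I_h.+1 * 'I_h.+1]|)%N.
  by rewrite cardsT card_prod card_ord mulnn.
apply: (leq_card_fibers (h := fun x => (x.1.2, x.2.2))) => [x _|[c d] _].
  by rewrite inE.
have [e|ne] := eqVneq (P.[d%:Z] - P.[c%:Z]) 0.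
  rewrite (_ : [set x in _ | _] = set0) ?cards0 //.
  apply/setP => -[[x y] [x' y']]; rewrite !inE /= !xpair_eqE.
  apply/negP => /andP[/andP[/negP ne _] /andP[/eqP ey /eqP ey']]; apply: ne.
  by move/eqP: e; rewrite subr_eq0 -ey -ey' eq_sym.
apply: leq_trans (leq_mul (leq_mul (hD _ _ ne) (leqnn 2)) (leqnn (size P))).
apply: leq_trans (card_horner_sub_eq _ P2 ne).
apply: (leq_card_inj_in (h := fun x => (x.1.1, x.2.1))).
  move=> [[x y] [x' y']]; rewrite !inE /= !xpair_eqE.
  move=> /andP[/andP[_ /eqP e] /andP[/eqP <- /eqP <-]].
  by rewrite -[P.[x%:Z]](addrK P.[y%:Z]) e; apply/eqP; ring.
move=> [[x y] [x' y']] [[z t] [z' t']]; rewrite !inE /= !xpair_eqE.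
by move=> /and3P[_ /eqP-> /eqP->] /and3P[_ /eqP-> /eqP->] [-> ->].
Qed.

(** * Energy of a polynomial over the prime field *)

Lemma natr_Fp_inj (p h : nat) : prime p -> (h < p)%N ->
  injective (fun x : 'I_h.+1 => (x : nat)%:R : 'F_p).
Proof.
move=> pp hp x y /(congr1 val) /=; rewrite !val_Fp_nat //.
rewrite !modn_small; first by move/val_inj.
  by apply: leq_trans hp; rewrite ltn_ord.
by apply: leq_trans hp; rewrite ltn_ord.
Qed.

(** This settles the case of a linear integer relation. If x1 = x3 then x2 = x4; otherwise x1 and x3
    fix c = x1 - x3, and x2 is a root of a shifted difference of g, nonzero because deg g < p. *)
Lemma card_add_and_poly_le (p h : nat) (g : {poly 'F_p}) :
  prime p -> (h < p)%N -> (2 < size g <= p)%N ->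
  (#|[set x : ('I_h.+1 * 'I_h.+1) * ('I_h.+1 * 'I_h.+1) |
       (x.1.1 + x.1.2 == x.2.1 + x.2.2)%N &&
       (g.[(x.1.1 : nat)%:R] + g.[(x.1.2 : nat)%:R] ==
        g.[(x.2.1 : nat)%:R] + g.[(x.2.2 : nat)%:R])%R]| <=
     h.+1 ^ 2 * (1 + size g))%N.
Proof.
move=> pp hp /andP[g2 gp]; set S := [set x | _].
have iota_inj := natr_Fp_inj pp hp.
have n0 : ((size g).-1)%:R != 0 :> 'F_p.
  rewrite -(dvdn_pcharf (pchar_Fp pp)) gtnNdvd //; first by lia.
  by apply: leq_trans gp; lia.
pose B := [set x : ('I_h.+1 * 'I_h.+1) * ('I_h.+1 * 'I_h.+1) | x.1.1 == x.2.1].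
have cT : (h.+1 ^ 2 = #|[set: 'I_h.+1 * 'I_h.+1]|)%N.
  by rewrite cardsT card_prod card_ord mulnn.
rewrite -(cardsID B S) mulnDr cT muln1; apply: leq_add.
  apply: (leq_card_inj_in (h := fun x => x.1)) => [x _|]; first by rewrite inE.
  move=> [[x y] [x' y']] [[z t] [z' t']]; rewrite !inE /=.
  move=> /andP[/andP[/eqP + _] /eqP ex] /andP[/andP[/eqP + _] /eqP ez] [exz eyt].
  rewrite -ex -ez -exz -eyt => /addnI e /addnI e'.
  by congr ((_, _), (_, _)); apply: val_inj; rewrite /= -e -e'.
apply: (leq_card_fibers (h := fun x => (x.1.1, x.2.1))) => [x _|[a b] _].
  by rewrite inE.
have [e|ne] := eqVneq a b.
  rewrite (_ : [set x in _ | _] = set0) ?cards0 //.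
  apply/setP => -[[x y] [x' y']]; rewrite !inE /= !xpair_eqE.
  by apply/negP => /andP[/andP[/negP ne _] /andP[/eqP ey /eqP ey']]; apply: ne;
    rewrite ey ey' e.
have c0 : (a : nat)%:R - (b : nat)%:R != 0 :> 'F_p.
  by rewrite subr_eq0; apply: contra ne => /eqP/iota_inj->.
apply: leq_trans (card_shift_eq_le iota_inj
  (g.[(a : nat)%:R] - g.[(b : nat)%:R]) g2 n0 c0).
apply: (leq_card_inj_in (h := fun x => x.1.2)).
  move=> [[x y] [x' y']]; rewrite !inE /= !xpair_eqE.
  move=> /andP[/andP[_ /andP[/eqP e1 /eqP e]] /andP[/eqP <- /eqP <-]].
  have -> : (y : nat)%:R + ((x : nat)%:R - (x' : nat)%:R) = (y' : nat)%:R :> 'F_p.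
    by rewrite addrA [_ + x%:R]addrC -natrD e1 natrD addrAC subrr add0r.
  by rewrite -[g.[(x : nat)%:R]](addrK g.[(y : nat)%:R]) e; apply/eqP; ring.
move=> [[x y] [x' y']] [[z t] [z' t']]; rewrite !inE /= !xpair_eqE.
move=> /andP[/andP[_ /andP[/eqP e1 _]] /andP[/eqP ex /eqP ex']].
move=> /andP[/andP[_ /andP[/eqP e2 _]] /andP[/eqP ez /eqP ez']] eyt.
move: e1 e2; rewrite ex ex' ez ez' eyt => -> /addnI e.
by congr (_, (_, _)); apply: val_inj.
Qed.

Lemma PoszX (a k : nat) : (a ^ k)%N%:Z = a%:Z ^+ k.
Proof. by rewrite -!natz natrX. Qed.

Lemma sum_succ_bin2 (d : nat) : (\sum_(k < d) k.+1 = 'C(d.+1, 2))%N.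
Proof.
elim: d => [|d IHd]; first by rewrite big_ord0.
by rewrite big_ord_recr /= IHd [RHS]binS bin1.
Qed.

Lemma horner_recl (R : comNzRingType) (g : {poly R}) (x : R) : (0 < size g)%N ->
  g.[x] = g`_0 + \sum_(k < (size g).-1) g`_k.+1 * x ^+ k.+1.
Proof.
move=> g0; rewrite horner_coef; case E: (size g) g0 => [|d] // _.
by rewrite big_ord_recl /= expr0 mulr1.
Qed.

(* s_k = x1^(k+1) + x2^(k+1) - x3^(k+1) - x4^(k+1), over the solutions of
   g(x1) + g(x2) = g(x3) + g(x4): the vectors s lie in a lattice of index p, and
   the bound on h makes any determinant formed from them smaller than p, so they
   satisfy an integer linear relation b. That relation lifts the equation
   modulo p to an equation over the integers. *)
Lemma energy_Fp_poly_le (p h D : nat) (g : {poly 'F_p}) :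
  let d := (size g).-1 in
  prime p -> (2 < size g <= p)%N -> (h < p)%N ->
  (d`! * 2 ^ d * h ^ 'C(d.+1, 2) < p)%N ->
  (forall N, (0 < N <= 2 * d * (d`! * (2 * h.+1 ^ d) ^ d) * h.+1 ^ d)%N ->
     (size (divisors N) <= D)%N) ->
  (energy (fun x : 'I_h.+1 => g.[(x : nat)%:R]) <=
     h.+1 ^ 2 * (d.+1 ^ 2 + D * 2 * d.+1 + d.+2))%N.
Proof.
move=> d pp g2p hp smallp hD; have /andP[g2 gp] := g2p.
have Eg : size g = d.+1 by rewrite /d; lia.
have d2 : (1 < d)%N by lia.
have d1d : (d.-1 < d)%N by lia.
have g_gt0 : (0 < size g)%N by exact: ltnW (ltnW g2).
rewrite /energy /coincidences; set S := [set x | _].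
pose T := {x | x \in S}.
pose s (t : T) (k : 'I_d) : int :=
  ((val t).1.1 ^ k.+1 + (val t).1.2 ^ k.+1)%N%:Z -
  ((val t).2.1 ^ k.+1 + (val t).2.2 ^ k.+1)%N%:Z.
have s_le (t : T) k : `|s t k| <= (2 * h ^ k.+1)%N%:Z.
  rewrite /s; case: (val t) => [[x y] [x' y']] /=.
  have lex (z : 'I_h.+1) : (z ^ k.+1 <= h ^ k.+1)%N.
    by apply: leq_exp2rW; rewrite -ltnS.
  by have := lex x; have := lex y; have := lex x'; have := lex y'; lia.
have s_leB (t : T) k : `|s t k| <= (2 * h.+1 ^ d)%N%:Z.
  apply: le_trans (s_le t k) _; rewrite lez_nat leq_mul2l /=.
  apply: leq_trans (leq_exp2rW _ (leqnSn h)) _.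
  by rewrite leq_pexp2l.
have s_modp (t : T) : \sum_k (s t k)%:~R * g`_k.+1 = 0 :> 'F_p.
  (* The constant coefficient of [g] occurs twice on each side and cancels. *)
  have := valP t; rewrite inE => /eqP e; rewrite !(horner_recl _ g_gt0) in e.
  pose Q (z : 'I_h.+1) : 'F_p := \sum_(k < d) g`_k.+1 * (z : nat)%:R ^+ k.+1.
  have {}e : Q (val t).1.1 + Q (val t).1.2 = Q (val t).2.1 + Q (val t).2.2.
    by move: e; rewrite addrACA [RHS]addrACA => /addrI.
  have -> : \sum_k (s t k)%:~R * g`_k.+1 =
      Q (val t).1.1 + Q (val t).1.2 - (Q (val t).2.1 + Q (val t).2.2).
    rewrite /Q -!big_split -sumrB; apply: eq_bigr => k _ /=.
    by rewrite /s rmorphB /= -!pmulrn !natrD !natrX; ring.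
  by rewrite e subrr.
have B1 : 1 <= (2 * h.+1 ^ d)%N%:Z by rewrite lez_nat muln_gt0 expn_gt0.
have [[w]|[b [[k0 bk0] b_le b_rel]]] := det_neq0_or_relation B1 s_leB.
  set M := \matrix_(i, k) _ => /negP[].
  (* Modulo p, [M] kills the vector of nonconstant coefficients of [g], whose last entry is the
     leading coefficient. *)
  have dvdM : (p %| `|\det M|)%N.
    have -> : (p %| `|\det M|)%N = (p %| \det M)%Z by [].
    rewrite (dvdz_pcharf (pchar_Fp pp)) -det_map_mx -det_tr.
    apply/det0P; exists (\row_k g`_k.+1).
      apply/eqP => /rowP/(_ (Ordinal d1d)); rewrite !mxE /=.
      rewrite (ltn_predK d2) => /eqP; apply/negP; rewrite /d -lead_coefE.
      by rewrite lead_coef_eq0 -size_poly_gt0 (ltnW (ltnW g2)).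
    apply/rowP => i; rewrite !mxE -[RHS](s_modp (w i)); apply: eq_bigr => k _.
    by rewrite !mxE mulrC.
  apply: contraTT dvdM; rewrite -absz_gt0 => M_gt0.
  rewrite gtnNdvd //; apply: leq_ltn_trans smallp.
  rewrite -lez_nat abszE.
  (* Column k is bounded by 2 h^(k+1), and the exponents 1, ..., d add up to C(d + 1, 2). *)
  apply: le_trans (@norm_det_le _ _ (fun k => (2 * h ^ k.+1)%N%:Z) _) _ => [i k|].
    by rewrite mxE.
  have -> : \prod_(k < d) (2 * h ^ k.+1)%N%:Z = (\prod_(k < d) (2 * h ^ k.+1))%N%:Z.
    by rewrite -[RHS]natz natr_prod; apply: eq_bigr => k _; rewrite natz.
  rewrite -PoszM lez_nat big_split /= prod_nat_const card_ord.
  by rewrite -expn_sum sum_succ_bin2 mulnA.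
(* The relation [b] becomes a polynomial without constant term that satisfies the additive equation
   over the integers on all of [S]. *)
pose P : {poly int} := \sum_k b k *: 'X^(k.+1).
have PE x : P.[x] = \sum_k b k * x ^+ k.+1.
  by rewrite horner_sum; apply: eq_bigr => k _; rewrite !hornerE.
have coefP (k : 'I_d) : P`_k.+1 = b k.
  rewrite coef_sum (bigD1 k) //= coefZ coefXn eqxx mulr1 big1 ?addr0 // => j jk.
  by rewrite coefZ coefXn eqSS eq_sym (negPf (_ : (j : nat) != k)) ?mulr0.
have szP : (size P <= d.+1)%N.
  apply/leq_sizeP => j dj; rewrite coef_sum big1 // => k _.
  rewrite coefZ coefXn; case: eqP => [E|]; last by rewrite mulr0.
  by have := ltn_ord k; move: dj; rewrite E; lia.
have SP x : x \in S -> P.[x.1.1%:Z] + P.[x.1.2%:Z] = P.[x.2.1%:Z] + P.[x.2.2%:Z].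
  move=> xS; have := b_rel (exist _ x xS); rewrite !PE -!big_split /=.
  move=> /eqP e; apply/eqP; rewrite -subr_eq0 -sumrB; move: e; congr (_ == _).
  by apply: eq_bigr => k _; rewrite /s /= !PoszD !PoszX; ring.
(* A nonzero coefficient in degree at least 2 allows the divisor argument for [P]. *)
have [/existsP[k1 /andP[k1_gt0 bk1]]|] :=
    boolP [exists k : 'I_d, (0 < k)%N && (b k != 0)].
  have P2 : (2 < size P)%N.
    rewrite ltnNge; apply: contra bk1 => /leq_sizeP/(_ k1.+1 k1_gt0).
    by rewrite coefP => ->.
  apply: leq_trans (_ : energy (fun x : 'I_h.+1 => P.[x%:Z]) <= _)%N.
    apply: subset_leq_card; apply/subsetP => x xS.
    by rewrite inE SP.
  apply: leq_trans (@energy_int_poly_le h D P P2 _) _ => [x y ne|].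
    apply: hD; rewrite absz_gt0 ne /= -lez_nat abszE.
    have PB (z : 'I_h.+1) :
        `|P.[z%:Z]| <= (d * (d`! * (2 * h.+1 ^ d) ^ d) * h.+1 ^ d)%N%:Z.
      rewrite PE; apply: le_trans (ler_norm_sum _ _ _) _.
      rewrite -mulnA PoszM -[d%:Z]natz mulr_natl -[X in _ *+ X]card_ord -sumr_const.
      apply: ler_sum => k _; rewrite normrM PoszM; apply: ler_pM => //.
        by apply: le_trans (b_le k) _; rewrite [leRHS]PoszM PoszX.
      rewrite -PoszX ger0_norm // lez_nat.
      apply: leq_trans (leq_exp2rW _ (ltnW (ltn_ord z))) _.
      by rewrite leq_pexp2l.
    apply: le_trans (ler_normB _ _) _; apply: le_trans (lerD (PB x) (PB y)) _.
    by rewrite -PoszD lez_nat addnn -mul2n !mulnA.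
  rewrite leq_mul2l; apply/orP; right.
  apply: leq_trans (leq_addr _ _); apply: leq_add; first exact: leq_exp2rW.
  by rewrite leq_mul2l szP orbT.
(* Only the coefficient of X survives, so the relation says x1 + x2 = x3 + x4 over the integers. *)
rewrite negb_exists => /forallP b0.
have k00 : (k0 : nat) = 0%N.
  by have := b0 k0; rewrite bk0 andbT lt0n negbK => /eqP.
apply: leq_trans (leq_trans (card_add_and_poly_le pp hp g2p) _).
  apply: subset_leq_card; apply/subsetP => x xS.
  rewrite inE; apply/andP; split; last by move: xS; rewrite inE.
  have := b_rel (exist _ x xS); rewrite (bigD1 k0) //= big1 ?addr0.
    move/eqP; rewrite mulf_eq0 (negPf bk0) orbF /s /= k00 !expn1 subr_eq0.
    by rewrite eqz_nat.
  move=> k kk0; have := b0 k; rewrite negb_and negbK -leqNgt => /orP[|/eqP->].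
    by move=> k_le0; case/eqP: kk0; apply: val_inj => /=; lia.
  by rewrite mulr0.
by rewrite leq_mul2l Eg; lia.
Qed.

(** Moving a block of h + 1 integers to start at 0 replaces g by g(X + c). Each of the Q^4 choices
    of blocks for a quadruple is then a four-function coincidence. *)
Lemma energy_box_blocks (p H h Q E : nat) (g : {poly 'F_p}) :
  (2 * H < Q * h.+1)%N ->
  (forall c : 'F_p,
     energy (fun y : 'I_h.+1 => (g \Po ('X + c%:P)).[(y : nat)%:R]) <= E)%N ->
  (energy (fun x : 'I_(2 * H).+1 => g.[(box_int x)%:~R]) <= Q ^ 4 * E)%N.
Proof.
move=> HQ gE; rewrite /energy /coincidences; set S := [set x | _].
have qP (x : 'I_(2 * H).+1) : (x %/ h.+1 < Q)%N.
  by rewrite ltn_divLR //; apply: leq_ltn_trans HQ; rewrite -ltnS.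
pose q x := Ordinal (qP x).
pose r (x : 'I_(2 * H).+1) : 'I_h.+1 := Ordinal (ltn_pmod x (ltn0Sn h)).
pose c (j : 'I_Q) : 'F_p := ((j * h.+1)%N%:Z - H%:Z)%:~R.
have gq x : g.[(box_int x)%:~R] = (g \Po ('X + (c (q x))%:P)).[(r x : nat)%:R].
  rewrite horner_comp !hornerE /c /box_int /=; congr (g.[_]).
  rewrite {1}(divn_eq x h.+1) !rmorphB /= -!pmulrn !natrD.
  by rewrite addrAC addrC.
have qr_inj x x' : q x = q x' -> x = x' %[mod h.+1] -> x = x'.
  move=> /(congr1 val)/= eq er; apply: val_inj => /=.
  by rewrite (divn_eq x h.+1) eq er -divn_eq.
have -> : (Q ^ 4 = #|[set: ('I_Q * 'I_Q) * ('I_Q * 'I_Q)]|)%N.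
  by rewrite cardsT !card_prod !card_ord; lia.
apply: (leq_card_fibers (h := fun x =>
  ((q x.1.1, q x.1.2), (q x.2.1, q x.2.2)))) => [x _|]; first by rewrite inE.
move=> [[j1 j2] [j3 j4]] _.
apply: leq_trans (coincidences_sum4 (gE (c j1)) (gE (c j2)) (gE (c j3)) (gE (c j4))).
apply: (leq_card_inj_in (h := fun x => ((r x.1.1, r x.1.2), (r x.2.1, r x.2.2)))).
  move=> [[x y] [x' y']]; rewrite !inE !gq [_.1.1]/= [_.1.2]/= [_.2.1]/= [_.2.2]/=.
  by move=> /andP[e /eqP[<- <- <- <-]].
move=> [[x y] [x' y']] [[z t] [z' t']]; rewrite !inE.
rewrite ![_.1.1]/= ![_.1.2]/= ![_.2.1]/= ![_.2.2]/=.
move=> /andP[_ /eqP[e1 e2 e3 e4]] /andP[_ /eqP[]].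
rewrite -e1 -e2 -e3 -e4 => f1 f2 f3 f4 [k1 k2 k3 k4].
by rewrite (qr_inj _ _ (esym f1) k1) (qr_inj _ _ (esym f2) k2)
  (qr_inj _ _ (esym f3) k3) (qr_inj _ _ (esym f4) k4).
Qed.

(** The bound H^(2+o(1)) on the energy, raised to the power k to stay in the naturals. The divisor
    bound is applied to integers of size O(H^(e^2 + e)), whence the extra exponent. *)
Lemma energy_box_le (e k : nat) : exists C : nat,
  forall (H p : nat) (g : {poly 'F_p}),
  (0 < H)%N -> prime p -> (e < p)%N -> (2 <= (size g).-1 <= e)%N ->
  (H ^ 'C(e.+1, 2) <= p)%N ->
  (energy (fun x : 'I_(2 * H).+1 => g.[(box_int x)%:~R]) ^ k <=
     C * H ^ (2 * k + (e ^ 2 + e)))%N.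
Proof.
have [C1 C1_gt0 hC1] := divisor_bound k.
(* Blocks are shorter than H by a factor exceeding e! 2^e, so that H^C(d+1,2) <= p yields d! 2^d
   h^C(d+1,2) < p for d <= e. *)
pose K := (e`! * 2 ^ e).+1.
pose W := (4 * (e.+1 ^ 2 + 2 * e.+1 + e.+2))%N.
pose C2 := (2 * e * (e`! * (2 * 2 ^ e) ^ e) * 2 ^ e)%N.
exists (((2 * K) ^ 4 * W * 2) ^ k * (C1 * C2.+1))%N.
move=> H p g H_gt0 pp ep /andP[d2 de] Hp.
set d := (size g).-1 in d2 de.
have Eg : size g = d.+1 by move: d2; rewrite /d; lia.
have K_gt1 : (1 < K)%N by rewrite ltnS muln_gt0 fact_gt0 expn_gt0.
pose h := (H %/ K)%N.
have hH : (h < H)%N by rewrite ltn_Pdiv.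
have hKH : (h * K <= H)%N by rewrite leq_trunc_div.
have Hpe (c : nat) : (c <= 'C(e.+1, 2))%N -> (H ^ c <= p)%N.
  by move=> ce; apply: leq_trans Hp; rewrite leq_pexp2l.
have hp : (h < p)%N.
  apply: leq_trans hH _; rewrite -(expn1 H); apply: Hpe.
  by rewrite bin_gt0; apply: leq_trans d2 (leq_trans de (leqnSn e)).
have smallp : (d`! * 2 ^ d * h ^ 'C(d.+1, 2) < p)%N.
  have cd : (0 < 'C(d.+1, 2))%N by rewrite bin_gt0; apply: ltnW.
  have [->|h_gt0] := posnP h; first by rewrite exp0n // muln0 prime_gt0.
  apply: leq_trans (Hpe 'C(d.+1, 2) _); last exact: leq_bin2l.
  apply: leq_trans (leq_exp2rW _ hKH); rewrite expnMn mulnC ltn_mul2l.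
  rewrite expn_gt0 h_gt0 /=; apply: (@leq_trans (K ^ 1)); last by rewrite leq_pexp2l.
  by rewrite expn1 ltnS leq_mul ?leq_fact ?leq_pexp2l.
pose bnd := (2 * d * (d`! * (2 * h.+1 ^ d) ^ d) * h.+1 ^ d)%N.
have bnd_le : (bnd <= C2 * H ^ (e ^ 2 + e))%N.
  have hde : (h.+1 ^ d <= 2 ^ e * H ^ e)%N.
    rewrite -expnMn; apply: leq_trans (_ : (2 * H) ^ d <= _)%N.
      by apply: leq_exp2rW; lia.
    by rewrite leq_pexp2l // muln_gt0.
  have -> : (C2 * H ^ (e ^ 2 + e) = 2 * e * (e`! * (2 * (2 ^ e * H ^ e)) ^ e) *
      (2 ^ e * H ^ e))%N.
    rewrite /C2 expnD -mulnn expnM !expnMn.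
    move: ((2 ^ e) ^ e)%N ((H ^ e) ^ e)%N (2 ^ e)%N (H ^ e)%N e`! => u v a b f.
    by ring.
  apply: leq_mul => //; apply: leq_mul; first by rewrite leq_mul2l.
  apply: leq_mul; first exact: leq_fact.
  apply: leq_trans (leq_exp2rW _ (_ : _ <= 2 * (2 ^ e * H ^ e))%N) _.
    by rewrite leq_mul2l.
  by rewrite leq_pexp2l // !muln_gt0 !expn_gt0 H_gt0.
(* The 1 keeps [D] positive, so that the terms of the energy bound without [D] can be absorbed into
   multiples of [D]. *)
pose D := maxn 1 (\max_(N < bnd.+1 | (0 < N)%N) size (divisors N)).
have D_gt0 : (0 < D)%N by rewrite leq_max.
have hD N : (0 < N <= bnd)%N -> (size (divisors N) <= D)%N.
  move=> /andP[N_gt0 Nb]; rewrite leq_max; apply/orP; right.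
  by rewrite -ltnS in Nb; apply: (leq_bigmax_cond (Ordinal Nb)).
have Dk : (D ^ k <= C1 * (C2.+1 * H ^ (e ^ 2 + e)))%N.
  have max_le a b X : (a ^ k <= X)%N -> (b ^ k <= X)%N -> (maxn a b ^ k <= X)%N.
    by move=> aX bX; case: (leqP a b).
  have X_gt0 : (0 < C1 * (C2.+1 * H ^ (e ^ 2 + e)))%N.
    by rewrite !muln_gt0 C1_gt0 expn_gt0 H_gt0.
  apply: (max_le) => //; first by rewrite exp1n.
  elim/big_rec: _ => [|N x N_gt0 IH].
    by case: (k) => [|j]; rewrite ?expn0 ?exp0n.
  apply: max_le => //; apply: leq_trans (hC1 _ N_gt0) _.
  rewrite leq_mul2l; apply/orP; right; have Nb : (N <= bnd)%N by rewrite -ltnS.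
  apply: leq_trans Nb (leq_trans bnd_le _).
  by rewrite leq_mul2r leqnSn orbT.
have Eb : (energy (fun x : 'I_(2 * H).+1 => g.[(box_int x)%:~R]) <=
    (2 * K) ^ 4 * (h.+1 ^ 2 * (d.+1 ^ 2 + D * 2 * d.+1 + d.+2)))%N.
  apply: energy_box_blocks => [|c].
    by rewrite -mulnA ltn_mul2l /= [(K * _)%N]mulnC; apply: ltn_ceil; exact: ltnW.
  have sz : size (g \Po ('X + c%:P)) = size g.
    by rewrite size_comp_poly2 // size_XaddC.
  have := @energy_Fp_poly_le p h D (g \Po ('X + c%:P)); rewrite /= sz -/d.
  by apply => //; rewrite Eg !ltnS d2 /=; apply: leq_ltn_trans ep.
have Eb2 : (energy (fun x : 'I_(2 * H).+1 => g.[(box_int x)%:~R]) <=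
    (2 * K) ^ 4 * W * 2 * (H ^ 2 * D))%N.
  apply: leq_trans Eb _; move: ((2 * K) ^ 4)%N => a.
  rewrite -!(mulnA a) leq_mul2l; apply/orP; right.
  apply: (@leq_trans ((2 * H) ^ 2 * ((e.+1 ^ 2 + 2 * e.+1 + e.+2) * (2 * D)))%N).
    apply: leq_mul; first by apply: leq_exp2rW; lia.
    have D2 : (0 < 2 * D)%N by rewrite muln_gt0.
    rewrite !mulnDl !leq_add //.
    - by apply: leq_trans (leq_pmulr _ D2); apply: leq_exp2rW.
    - by rewrite mulnC [(D * 2)%N]mulnC leq_mul2r; apply/orP; right; lia.
    - by apply: leq_trans (leq_pmulr _ D2).
  rewrite /W expnMn; move: (H ^ 2)%N (_ + _ + _)%N => v u.
  by rewrite leq_eqVlt; apply/orP; left; apply/eqP; ring.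
apply: leq_trans (leq_exp2rW k Eb2) _; move: ((2 * K) ^ 4 * W * 2)%N => a.
rewrite expnD expnM; move: (H ^ 2)%N => H2.
rewrite !expnMn -(mulnA (a ^ k)%N); apply: leq_mul => //.
by rewrite [leqRHS]mulnCA; apply: leq_mul => //; rewrite -mulnA.
Qed.

(** * Matrices of given rank with entries in prescribed sets *)

Lemma card_ffun_box_le (I U : finType) (A : I -> {set U}) (D : {set I}) (k : nat) :
  (forall i, i \in D -> #|A i| <= 1)%N ->
  (forall i, i \notin D -> #|A i| <= k)%N ->
  (#|[set f : {ffun I -> U} | [forall i, f i \in A i]]| <= k ^ (#|I| - #|D|))%N.
Proof.
move=> hD hk.
have -> : #|[set f : {ffun I -> U} | [forall i, f i \in A i]]| =
    #|family (fun i => mem (A i))|.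
  by apply: eq_card => f; rewrite !inE; apply/forallP/familyP.
rewrite card_family foldrE big_map big_enum /=.
rewrite (bigID (mem D)) /= -[leqRHS]mul1n; apply: leq_mul.
  apply: (big_ind (fun x => x <= 1)%N) => // x y x1 y1.
  by rewrite -[1%N]muln1 leq_mul.
apply: (@leq_trans (\prod_(i | i \notin D) k)%N).
  by apply: leq_prod => i /hk.
rewrite prod_nat_const; apply: eq_leq; congr (_ ^ _)%N.
have := cardsCs (~: D); rewrite setCK => <-.
by apply: eq_card => i; rewrite inE unfold_in.
Qed.

Section RankCount.
Variable F : finFieldType.

Definition nz_set (k : nat) (c : 'I_k -> F) : {set 'I_k} := [set i | c i != 0].

(** The coordinates outside [K] are chosen freely; their share of the sum becomes the constant [v],
    and [T] bounds the completions. *)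
Lemma card_linear_constraint_le (k N T : nat) (V : 'I_k -> {set F}) (V0 : {set F})
    (c : 'I_k -> F) (K : {set 'I_k}) :
  (forall i, #|V i| <= N)%N ->
  (forall v : F, #|[set u : {ffun 'I_k -> F} |
      [&& [forall (i | i \in K), u i \in V i], [forall (i | i \notin K), u i == 0]
        & \sum_(i in K) c i * u i + v \in V0]%R]| <= T)%N ->
  (#|[set u : {ffun 'I_k -> F} |
       [forall i, u i \in V i] && (\sum_i c i * u i \in V0)%R]| <=
     N ^ (k - #|K|) * T)%N.
Proof.
move=> hN hT; set S := [set u | _].
(* A partial vector is encoded as a total one, padded with zeros. *)
pose mask (P : pred 'I_k) (u : {ffun 'I_k -> F}) : {ffun 'I_k -> F} :=
  [ffun i => if P i then u i else 0].
pose A i : {set F} := if i \in K then [set 0] else V i.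
have cA : (#|[set f : {ffun 'I_k -> F} | [forall i, f i \in A i]]| <=
    N ^ (k - #|K|))%N.
  rewrite -[k in (k - _)%N]card_ord; apply: card_ffun_box_le => i iK.
    by rewrite /A iK cards1.
  by rewrite /A (negPf iK).
apply: leq_trans (leq_mul cA (leqnn T)).
apply: (leq_card_fibers (h := mask (fun i => i \notin K))) => [u|y _].
  rewrite !inE => /andP[/forallP uV _]; apply/forallP => i.
  by rewrite ffunE /A; case: (i \in K); rewrite ?inE ?uV.
apply: leq_trans (hT (\sum_(i | i \notin K) c i * y i)).
apply: (leq_card_inj_in (h := mask (fun i => i \in K))) => [u|u u'].
  rewrite !inE => /andP[/andP[/forallP uV uV0] /eqP<-]; apply/and3P; split.
  - by apply/forallP => i; apply/implyP => iK; rewrite ffunE iK uV.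
  - by apply/forallP => i; apply/implyP => iK; rewrite ffunE (negPf iK).
  - rewrite (eq_bigr (fun i => c i * u i)) => [|i iK]; last by rewrite ffunE iK.
    rewrite [X in _ + X](eq_bigr (fun i => c i * u i)) => [|i iK].
      by move: uV0; rewrite (bigID (mem K)).
    by rewrite ffunE iK.
rewrite !inE => /andP[_ /eqP ey] /andP[_ /eqP ey'] e; apply/ffunP => i.
have [iK|iK] := boolP (i \in K).
  by move/ffunP/(_ i): e; rewrite !ffunE iK.
by move: ey; rewrite -ey' => /ffunP/(_ i); rewrite !ffunE iK.
Qed.

Lemma card_linear_constraint2_le (k N T : nat) (V : 'I_k -> {set F})
    (V0 : {set F}) (c : 'I_k -> F) :
  (forall i, #|V i| <= N)%N ->
  (forall i j (a b v : F), a != 0 -> b != 0 ->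
    (#|[set u : F * F | [&& u.1 \in V i, u.2 \in V j &
        a * u.1 + b * u.2 + v \in V0]%R]| <= T)%N) ->
  #|nz_set c| = 2%N ->
  (#|[set u : {ffun 'I_k -> F} |
       [forall i, u i \in V i] && (\sum_i c i * u i \in V0)%R]| <=
     N ^ (k - 2) * T)%N.
Proof.
move=> hN hT c2; rewrite -c2; apply: card_linear_constraint_le => // v.
move/eqP/cards2P: c2 => [i [j [ij Ec]]].
have ci : c i != 0 by have := set21 i j; rewrite -Ec inE.
have cj : c j != 0 by have := set22 i j; rewrite -Ec inE.
apply: leq_trans (hT i j _ _ v ci cj).
rewrite {}Ec.
apply: (leq_card_inj_in (h := fun u : {ffun _ -> F} => (u i, u j))) => [u|u u'].
  rewrite !inE => /and3P[/forallP uV _ uV0]; have := uV i; have := uV j.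
  rewrite !inE !eqxx orbT /= => -> -> /=.
  by move: uV0; rewrite big_setU1 ?inE //= big_set1.
rewrite !inE => /and3P[_ /forallP u0 _] /and3P[_ /forallP u'0 _] [eui euj].
apply/ffunP => l; have := u0 l; have := u'0 l; rewrite !inE.
by case: (l =P i) => [->|_] //=; case: (l =P j) => [->|_] //= /eqP-> /eqP->.
Qed.

(** Three coordinates of the support suffice; any further ones enter the constant. *)
Lemma card_linear_constraint3_le (k N T : nat) (V : 'I_k -> {set F})
    (V0 : {set F}) (c : 'I_k -> F) :
  (forall i, #|V i| <= N)%N ->
  (forall i j l (a b d v : F), a != 0 -> b != 0 -> d != 0 ->
    (#|[set u : F * (F * F) | [&& u.1 \in V i, u.2.1 \in V j, u.2.2 \in V l &
        a * u.1 + b * u.2.1 + d * u.2.2 + v \in V0]%R]| <= T)%N) ->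
  (3 <= #|nz_set c|)%N ->
  (#|[set u : {ffun 'I_k -> F} |
       [forall i, u i \in V i] && (\sum_i c i * u i \in V0)%R]| <=
     N ^ (k - 3) * T)%N.
Proof.
move=> hN hT /card_gt2P[i [j [l [[si sj sl] [ij jl li]]]]].
move: si sj sl; rewrite !inE => ci cj cl.
have c3 : #|[set i; j; l]| = 3%N.
  by rewrite setUC cardsU1 !inE negb_or li [l == j]eq_sym jl cards2 ij.
rewrite -c3; apply: card_linear_constraint_le => // v.
apply: leq_trans (hT i j l _ _ _ v ci cj cl).
apply: (leq_card_inj_in (h := fun u : {ffun _ -> F} => (u i, (u j, u l)))) => [u|u u'].
  rewrite !inE => /and3P[/forallP uV _ uV0]; have := uV i; have := uV j; have := uV l.
  rewrite !inE !eqxx ?orbT /= => -> -> -> /=.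
  move: uV0; rewrite setUC big_setU1 ?inE ?negb_or ?li ?[l == j]eq_sym ?jl //=.
  by rewrite big_setU1 ?inE //= big_set1 addrC -addrA addrC -!addrA (addrC v).
rewrite !inE => /and3P[_ /forallP u0 _] /and3P[_ /forallP u'0 _] [eui euj eul].
apply/ffunP => x; have := u0 x; have := u'0 x; rewrite !inE.
case: (x =P i) => [->|_] //=; case: (x =P j) => [->|_] //=.
by case: (x =P l) => [->|_] //= /eqP-> /eqP->.
Qed.

(** A vector of the row space is determined by its coordinates at \rank B independent columns of
    [B]. *)
Lemma card_rowspace_box_le (a k N : nat) (B : 'M[F]_(a, k)) (V : 'I_k -> {set F}) :
  (forall i, #|V i| <= N)%N ->
  (#|[set y : 'rV[F]_k | (y <= B)%MS && [forall i, y ord0 i \in V i]]| <=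
     N ^ \rank B)%N.
Proof.
move=> hN; pose g := maxrankfun B^T.
have [D ED] : exists D, B^T = D *m rowsub g B^T.
  by apply/submxP; rewrite eq_maxrowsub.
have yE (y : 'rV_k) : (y <= B)%MS -> y^T = D *m rowsub g y^T.
  by case/submxP => c ->; rewrite trmx_mul {1}ED -mulmxA mul_rowsub_mx.
rewrite -(mxrank_tr B).
have := @card_ffun_box_le 'I_(\rank B^T) _ (fun i => V (g i)) set0 N.
rewrite cards0 subn0 card_ord => box; apply: leq_trans (box _ _).
- apply: (leq_card_inj_in (h := fun y : 'rV_k => [ffun i => y ord0 (g i)])).
    move=> y; rewrite !inE => /andP[_ /forallP yV]; apply/forallP => i.
    by rewrite ffunE yV.
  move=> y y'; rewrite !inE => /andP[yB _] /andP[y'B _] /ffunP e.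
  apply: trmx_inj; rewrite (yE _ yB) (yE _ y'B); congr (_ *m _).
  by apply/matrixP => i j; have := e i; rewrite !ffunE !mxE !(ord1 j).
- by move=> i; rewrite inE.
- by move=> i _; apply: hN.
Qed.

(** Once one of at most 2^k supports is fixed, y lies in the span of at most t rows of [A]. *)
Lemma card_support_rows_le (k N t : nat) (A : 'M[F]_k) (V : 'I_k -> {set F}) :
  A \in unitmx -> (0 < N)%N -> (forall i, #|V i| <= N)%N ->
  (#|[set y : 'rV[F]_k | [forall i, y ord0 i \in V i] &&
       (#|nz_set ((y *m invmx A) ord0)| <= t)%N]| <= 2 ^ k * N ^ t)%N.
Proof.
move=> uA N_gt0 hN; set S := [set y | _].
pose S' := [set T : {set 'I_k} | (#|T| <= t)%N].
have cS' : (#|S'| <= 2 ^ k)%N.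
  apply: leq_trans (max_card _) _.
  by rewrite -cardsT -powersetT card_powerset cardsT card_ord.
apply: leq_trans (leq_mul cS' (leqnn _)).
apply: (leq_card_fibers (h := fun y => nz_set ((y *m invmx A) ord0))).
  by move=> y; rewrite !inE => /andP[_ ->].
move=> T; rewrite inE => Tt.
pose B : 'M_(#|T|, k) := rowsub (fun i => enum_val i) A.
apply: leq_trans (_ : N ^ \rank B <= _)%N; last first.
  by rewrite leq_pexp2l // (leq_trans (rank_leq_row _)).
apply: leq_trans (card_rowspace_box_le B hN); apply: subset_leq_card.
apply/subsetP => y; rewrite !inE => /andP[/andP[-> _] /eqP ET]; rewrite andbT.
rewrite -[y](mulmxKV uA) mulmx_sum_row; apply: summx_sub => i _.
have [->|nz] := eqVneq ((y *m invmx A) 0 i) 0; first by rewrite scale0r sub0mx.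
have iT : i \in T by rewrite -ET inE.
apply: scalemx_sub.
have -> : row i A = row (enum_rank_in iT i) B.
  by apply/rowP => j; rewrite !mxE enum_rankK_in.
exact: row_sub.
Qed.

End RankCount.

(** * Counting matrices through an invertible block *)

Section RankCountBound.
Variable F : finFieldType.

Lemma eq_nz_set (k : nat) (c c' : 'I_k -> F) : c =1 c' -> nz_set c = nz_set c'.
Proof. by move=> e; apply/setP => i; rewrite !inE e. Qed.

Lemma exists_unit_minor (m n r : nat) (M : 'M[F]_(m, n)) : \rank M = r ->
  exists (I : {ffun 'I_r -> 'I_m}) (J : {ffun 'I_r -> 'I_n}),
    [/\ injective I, injective J & mxsub I J M \in unitmx].
Proof.
move=> <-; pose I := maxrankfun M.
have fullB : row_full (rowsub I M)^T.
  by rewrite -col_leq_rank mxrank_tr row_leq_rank maxrowsub_free.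
exists I, (fullrankfun fullB); split.
- exact: maxrankfun_inj.
- exact: fullrankfun_inj.
- rewrite -unitmx_tr (_ : _^T = rowsub (fullrankfun fullB) (rowsub I M)^T).
    exact: fullrowsub_unit.
  by apply/matrixP => i j; rewrite !mxE.
Qed.

(** The skeleton decomposition: the rows I span the row space, so M = Q R with R these rows, and
    restriction to the columns J identifies Q. *)
Lemma unit_minor_factor (m n r : nat) (M : 'M[F]_(m, n)) (I : 'I_r -> 'I_m)
    (J : 'I_r -> 'I_n) : \rank M = r -> mxsub I J M \in unitmx ->
  M = colsub J M *m invmx (mxsub I J M) *m rowsub I M.
Proof.
move=> rM uM; have rI : (r <= \rank (rowsub I M))%N.
  rewrite -{1}(mxrank_unit uM).
  have -> : mxsub I J M = rowsub I M *m colsub J 1%:M.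
    by rewrite mulmx_colsub mulmx1 -mxsubcr.
  exact: mxrankM_maxl.
have /submxP[Q EQ] : (M <= rowsub I M)%MS.
  by rewrite -(geq_leqif (mxrank_leqif_sup (rowsub_sub I M))) rM.
have EJ : colsub J M = Q *m mxsub I J M.
  by rewrite {1}EQ -mulmx_colsub -mxsubcr.
by rewrite EJ mulmxK.
Qed.

Variables (m n r N : nat) (V : 'I_m -> 'I_n -> {set F}).
Hypothesis N_gt0 : (0 < N)%N.
Hypothesis V_le : forall i j, (#|V i j| <= N)%N.

(* Row i of Y *m invmx (rowsub I Y) holds the coefficients of row i of Y as a
   combination of the rows I. *)
Definition sparse_cols (I : 'I_r -> 'I_m) (J : 'I_r -> 'I_n) (t : nat) :=
  [set Y : 'M[F]_(m, r) | [&& [forall i, forall k, Y i k \in V i (J k)],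
     rowsub I Y \in unitmx &
     [forall i, (#|nz_set ((Y *m invmx (rowsub I Y)) i)| <= t)%N]]].

(** The block has r^2 entries; once it is fixed, each of the m - r rows outside I is a combination
    of at most t block rows. *)
Lemma card_sparse_cols_le (I : 'I_r -> 'I_m) (J : 'I_r -> 'I_n) (t : nat) :
  injective I ->
  (#|sparse_cols I J t| <= N ^ (r * r) * (2 ^ r * N ^ t) ^ (m - r))%N.
Proof.
move=> I_inj.
pose U := [set A : 'M[F]_r | (A \in unitmx) &&
  [forall k, forall l, A k l \in V (I k) (J l)]].
have cU : (#|U| <= N ^ (r * r))%N.
  have := @card_ffun_box_le ('I_r * 'I_r)%type _
    (fun x => V (I x.1) (J x.2)) set0 N.
  rewrite cards0 subn0 card_prod card_ord => box; apply: leq_trans (box _ _).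
  - apply: (leq_card_inj_in (h := fun A : 'M_r => [ffun x => A x.1 x.2])).
      move=> A; rewrite !inE => /andP[_ /forallP AV]; apply/forallP => x.
      by rewrite ffunE; have /forallP := AV x.1.
    move=> A A' _ _ /ffunP e; apply/matrixP => k l.
    by have := e (k, l); rewrite !ffunE.
  - by move=> x; rewrite inE.
  - by move=> x _.
apply: leq_trans (leq_mul cU (leqnn _)).
apply: (leq_card_fibers (h := fun Y => rowsub I Y)) => [Y|A].
  rewrite !inE => /and3P[/forallP YV -> _] /=; apply/forallP => k.
  by apply/forallP => l; rewrite mxE; have /forallP := YV (I k).
rewrite inE => /andP[uA _].
pose R i : {set 'rV[F]_r} := if [pick k | I k == i] is Some k then [set row k A]
  else [set y : 'rV[F]_r | [forall k, y ord0 k \in V i (J k)] &&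
         (#|nz_set ((y *m invmx A) ord0)| <= t)%N].
have := @card_ffun_box_le 'I_m _ R (I @: setT) (2 ^ r * N ^ t).
rewrite card_ord card_imset // cardsT card_ord => box.
apply: leq_trans (box _ _).
- apply: (leq_card_inj_in (h := fun Y : 'M_(m, r) => [ffun i => row i Y])).
    move=> Y; rewrite !inE => /andP[/and3P[/forallP YV _ /forallP Yt] /eqP EA].
    apply/forallP => i; rewrite ffunE /R; case: pickP => [k /eqP <-|_].
      by rewrite inE -EA; apply/eqP/rowP => l; rewrite !mxE.
    rewrite inE; apply/andP; split.
      by apply/forallP => k; rewrite mxE; have /forallP := YV i.
    move: (Yt i); rewrite EA => le_t.
    by rewrite (@eq_nz_set r _ ((Y *m invmx A) i)) // => k; rewrite -row_mul mxE.
  move=> Y Y' _ _ /ffunP e; apply/row_matrixP => i.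
  by have := e i; rewrite !ffunE.
- move=> _ /imsetP[k _ ->]; rewrite /R; case: pickP => [l _|/(_ k)].
    by rewrite cards1.
  by rewrite eqxx.
- move=> i iI; rewrite /R; case: pickP => [k /eqP Ek|_].
    by move: iI; rewrite -Ek imset_f.
  by apply: card_support_rows_le.
Qed.

(** With [C] computed from the columns J, these are the candidates for column j of a matrix of rank
    r. *)
Definition spanned_col (I : 'I_r -> 'I_m) (C : 'M[F]_(m, r)) (j : 'I_n) :=
  [set z : 'cV[F]_m | [forall i, z i ord0 \in V i j] && (z == C *m rowsub I z)].

(** The entries in the rows I determine the column; of the conditions on the remaining entries only
    the one in row [i0] is kept. *)
Lemma card_spanned_col_le (I : 'I_r -> 'I_m) (C : 'M[F]_(m, r)) (j : 'I_n)
    (i0 : 'I_m) :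
  (#|spanned_col I C j| <= #|[set u : {ffun 'I_r -> F} |
     [forall k, u k \in V (I k) j] && (\sum_k C i0 k * u k \in V i0 j)%R]|)%N.
Proof.
apply: (leq_card_inj_in (h := fun z : 'cV_m => [ffun k => z (I k) ord0])).
  move=> z; rewrite !inE => /andP[/forallP zV /eqP Ez]; apply/andP; split.
    by apply/forallP => k; rewrite ffunE.
  have := zV i0; rewrite {1}Ez mxE => zi0.
  rewrite (eq_bigr (fun k => C i0 k * rowsub I z k ord0)) // => k _.
  by rewrite ffunE mxE.
move=> z z'; rewrite !inE => /andP[_ /eqP Ez] /andP[_ /eqP Ez'] /ffunP e.
rewrite Ez Ez'; congr (_ *m _); apply/colP => k.
by have := e k; rewrite !ffunE !mxE.
Qed.

Lemma card_spanned_col_triv (I : 'I_r -> 'I_m) (C : 'M[F]_(m, r)) (j : 'I_n)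
    (i0 : 'I_m) : (#|spanned_col I C j| <= N ^ r)%N.
Proof.
apply: leq_trans (card_spanned_col_le I C j i0) _.
have := @card_ffun_box_le 'I_r _ (fun k => V (I k) j) set0 N.
rewrite cards0 subn0 card_ord => box; apply: leq_trans (box _ _).
- by apply: subset_leq_card; apply/subsetP => u; rewrite !inE => /andP[].
- by move=> x; rewrite inE.
- by move=> x _.
Qed.

Lemma card_extensions_le (I : 'I_r -> 'I_m) (J : 'I_r -> 'I_n)
    (Y C : 'M[F]_(m, r)) (W : nat) : injective J ->
  (forall j, #|spanned_col I C j| <= W)%N ->
  (#|[set M : 'M[F]_(m, n) | [&& [forall i, forall j, M i j \in V i j],
       M == C *m rowsub I M & colsub J M == Y]]| <= W ^ (n - r))%N.
Proof.
move=> J_inj hW.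
pose Z j : {set 'cV[F]_m} :=
  if [pick k | J k == j] is Some k then [set col k Y] else spanned_col I C j.
have := @card_ffun_box_le 'I_n _ Z (J @: setT) W.
rewrite card_ord card_imset // cardsT card_ord => box.
apply: leq_trans (box _ _).
- apply: (leq_card_inj_in (h := fun M : 'M_(m, n) => [ffun j => col j M])).
    move=> M; rewrite !inE => /and3P[/forallP MV /eqP EM /eqP EY].
    apply/forallP => j; rewrite ffunE /Z; case: pickP => [k /eqP <-|_].
      by rewrite inE -EY; apply/eqP/colP => l; rewrite !mxE.
    rewrite inE; apply/andP; split.
      by apply/forallP => i; rewrite mxE; have /forallP := MV i.
    apply/eqP/colP => i; rewrite mxE {1}EM !mxE; apply: eq_bigr => k _.
    by rewrite !mxE.
  move=> M M' _ _ /ffunP e; apply/matrixP => i j.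
  by have := e j; rewrite !ffunE => /colP/(_ i); rewrite !mxE.
- move=> _ /imsetP[k _ ->]; rewrite /Z; case: pickP => [l _|/(_ k)].
    by rewrite cards1.
  by rewrite eqxx.
- move=> j jJ; rewrite /Z; case: pickP => [k /eqP Ek|_]; last exact: hW.
  by move: jJ; rewrite -Ek imset_f.
Qed.

(** The matrix is built in two stages: first its columns J, then the n - r others, each spanned
    through the coefficients that the first stage fixes. *)
Lemma card_rank_class_le (I : 'I_r -> 'I_m) (J : 'I_r -> 'I_n) (t W : nat)
    (P : pred 'M[F]_(m, r)) : injective I -> injective J ->
  (forall Y j, P (Y *m invmx (rowsub I Y)) ->
     (#|spanned_col I (Y *m invmx (rowsub I Y)) j| <= W)%N) ->
  (forall C i, P C -> (#|nz_set (C i)| <= t)%N) ->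
  (#|[set M : 'M[F]_(m, n) | [&& [forall i, forall j, M i j \in V i j],
       \rank M == r, mxsub I J M \in unitmx &
       P (colsub J M *m invmx (mxsub I J M))]]| <=
     N ^ (r * r) * (2 ^ r * N ^ t) ^ (m - r) * W ^ (n - r))%N.
Proof.
move=> I_inj J_inj hW ht; set S := [set M | _].
pose S' := [set Y in sparse_cols I J t | P (Y *m invmx (rowsub I Y))].
apply: leq_trans (_ : #|S'| * W ^ (n - r) <= _)%N; last first.
  rewrite leq_mul2r; apply/orP; right.
  apply: leq_trans (card_sparse_cols_le J t I_inj); apply: subset_leq_card.
  by apply/subsetP => Y; rewrite inE => /andP[].
apply: (leq_card_fibers (h := fun M => colsub J M)) => [M|Y].
  rewrite !inE -!mxsubrc => /and4P[/forallP MV _ -> PM]; rewrite PM andbT /=.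
  apply/andP; split; last by apply/forallP => i; apply: ht.
  by apply/forallP => i; apply/forallP => k; rewrite mxE; have /forallP := MV i.
rewrite inE => /andP[_ PY].
apply: leq_trans (card_extensions_le Y J_inj (fun j => hW Y j PY)).
apply: subset_leq_card; apply/subsetP => M; rewrite !inE.
move=> /andP[/and4P[-> /eqP rM uM _] /eqP EY]; rewrite EY eqxx andbT /=.
by apply/eqP; rewrite -EY -mxsubrc; apply: unit_minor_factor.
Qed.

Variables (T3 T4 : nat).
Hypothesis T3_le : forall i i1 i2 j (a b v : F), a != 0 -> b != 0 ->
  (#|[set u : F * F | [&& u.1 \in V i1 j, u.2 \in V i2 j &
      a * u.1 + b * u.2 + v \in V i j]%R]| <= T3)%N.
Hypothesis T4_le : forall i i1 i2 i3 j (a b c v : F), a != 0 -> b != 0 -> c != 0 ->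
  (#|[set u : F * (F * F) |
      [&& u.1 \in V i1 j, u.2.1 \in V i2 j, u.2.2 \in V i3 j &
      a * u.1 + b * u.2.1 + c * u.2.2 + v \in V i j]%R]| <= T4)%N.

(* With t the largest number of block rows needed to express a row, the m - r
   rows outside the block cost N^t each, while t >= 2 (resp. t >= 3) makes each
   of the n - r columns outside the block obey a three-term (resp. four-term)
   linear equation. *)
Lemma card_rank_le : (0 < m)%N ->
  (#|[set M : 'M[F]_(m, n) |
       [forall i, forall j, M i j \in V i j] && (\rank M == r)]| <=
   (m ^ r * n ^ r).+1 *
   (N ^ (r * r) * (2 ^ r * N ^ 1) ^ (m - r) * (N ^ r) ^ (n - r) +
    N ^ (r * r) * (2 ^ r * N ^ 2) ^ (m - r) * (N ^ (r - 2) * T3) ^ (n - r) +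
    N ^ (r * r) * (2 ^ r * N ^ r) ^ (m - r) * (N ^ (r - 3) * T4) ^ (n - r)))%N.
Proof.
move=> m_gt0; set S := [set M | _].
pose minor (M : 'M[F]_(m, n)) (IJ : {ffun 'I_r -> 'I_m} * {ffun 'I_r -> 'I_n}) :=
  [&& injectiveb IJ.1, injectiveb IJ.2 & mxsub IJ.1 IJ.2 M \in unitmx].
set bnd := (X in (_ <= _ * X)%N).
(* The successor accounts for the value [None] of [pick]. *)
have -> : ((m ^ r * n ^ r).+1 =
    #|[set: option ({ffun 'I_r -> 'I_m} * {ffun 'I_r -> 'I_n})]|)%N.
  by rewrite cardsT card_option card_prod !card_ffun !card_ord.
apply: (leq_card_fibers (h := fun M => [pick IJ | minor M IJ])).
  by move=> M _; rewrite inE.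
move=> [[I J]|] _; last first.
  rewrite (_ : [set M in S | _] = set0) ?cards0 //.
  apply/setP => M; rewrite !inE; apply/negP => /andP[/andP[_ /eqP rM]].
  case: pickP => // none _; have [I [J [I_inj J_inj uM]]] := exists_unit_minor rM.
  by have := none (I, J); rewrite /minor uM /=
    (introT (injectiveP I) I_inj) (introT (injectiveP J) J_inj).
set S0 := [set M in S | _].
(* Any member of the fibre certifies that I and J are injective; an empty fibre needs no bound. *)
have [->|[M0]] := set_0Vmem S0; first by rewrite cards0.
rewrite inE => /andP[_]; case: pickP => [IJ minorIJ /eqP[EIJ]|//].
move: minorIJ; rewrite EIJ /minor /= => /and3P[/injectiveP I_inj /injectiveP J_inj _].
pose i0 : 'I_m := Ordinal m_gt0.
pose P1 (C : 'M[F]_(m, r)) := [forall i, (#|nz_set (C i)| <= 1)%N].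
pose P2 (C : 'M[F]_(m, r)) := [forall i, (#|nz_set (C i)| <= 2)%N] &&
  [exists i, (#|nz_set (C i)| == 2)%N].
pose P3 (C : 'M[F]_(m, r)) := [exists i, (3 <= #|nz_set (C i)|)%N].
have P123 C : [|| P1 C, P2 C | P3 C].
  have [_|] := boolP (P3 C); first by rewrite !orbT.
  rewrite negb_exists => /forallP le2; rewrite orbF.
  have le2' i : (#|nz_set (C i)| <= 2)%N by rewrite leqNgt le2.
  have [_|] := boolP (P2 C); first by rewrite orbT.
  rewrite negb_and; case/orP => [/negP[]|]; first exact/forallP.
  rewrite negb_exists orbF => /forallP ne2.
  by apply/forallP => i; have := le2' i; rewrite leq_eqVlt (negPf (ne2 i)).
pose cls (P : pred 'M[F]_(m, r)) :=
  [set M : 'M[F]_(m, n) | [&& [forall i, forall j, M i j \in V i j],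
     \rank M == r, mxsub I J M \in unitmx &
     P (colsub J M *m invmx (mxsub I J M))]].
have c1 := @card_rank_class_le I J 1 (N ^ r) P1 I_inj J_inj.
have c2 := @card_rank_class_le I J 2 (N ^ (r - 2) * T3) P2 I_inj J_inj.
(* In the third class the supports are bounded only by their trivial size [r]. *)
have c3 := @card_rank_class_le I J r (N ^ (r - 3) * T4) P3 I_inj J_inj.
apply: leq_trans (_ : #|cls P1 :|: cls P2 :|: cls P3| <= _)%N.
  apply: subset_leq_card; apply/subsetP => M; rewrite !inE.
  move=> /andP[/andP[MV rM]]; case: pickP => [x minorx /eqP[Ex]|//].
  move: minorx; rewrite Ex /minor /= => /and3P[_ _ uM].
  by have := P123 (colsub J M *m invmx (mxsub I J M)); rewrite MV rM uM /= orbA.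
apply: leq_trans (leq_card_setU _ _) _; apply: leq_add.
  apply: leq_trans (leq_card_setU _ _) _; apply: leq_add.
    apply: c1 => [Y j _|C i /forallP//]; exact: card_spanned_col_triv.
  apply: c2 => [Y j /andP[_ /existsP[i /eqP s2]]|C i /andP[/forallP//]].
  apply: leq_trans (card_spanned_col_le _ _ _ i) _.
  by apply: card_linear_constraint2_le => // *; apply: T3_le.
apply: c3 => [Y j /existsP[i s3]|C i _]; last first.
  by rewrite -[r in leqRHS]card_ord max_card.
apply: leq_trans (card_spanned_col_le _ _ _ i) _.
by apply: card_linear_constraint3_le => // *; apply: T4_le.
Qed.

End RankCountBound.

(** * From value matrices back to integer tuples *)

Lemma box_intr_inj (p H : nat) : prime p -> (2 * H < p)%N ->
  injective (fun x : 'I_(2 * H).+1 => (box_int x)%:~R : 'F_p).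
Proof.
move=> pp Hp x y; rewrite /box_int !rmorphB /= -!pmulrn => /addIr.
by apply: natr_Fp_inj.
Qed.

(** Passing to values loses a factor of at most e per entry. [E] itself bounds the four-term
    equations; [T3] dominates the integer square root of the three-term bound. *)
Lemma rank_count_le (p m n r e H E T3 N : nat) (f : 'M[{poly 'F_p}]_(m, n)) :
  prime p -> (0 < m)%N -> (2 * H < p)%N ->
  (forall i j, (2 <= (size (f i j)).-1 <= e)%N) ->
  (forall i j,
     energy (fun x : 'I_(2 * H).+1 => (f i j).[(box_int x)%:~R]) <= E)%N ->
  (forall x, x ^ 2 <= (2 * H).+1 * e * E -> x <= T3)%N ->
  N = (2 * H).+1 ->
  (rank_count f r H <= e ^ (m * n) * ((m ^ r * n ^ r).+1 *
   (N ^ (r * r) * (2 ^ r * N ^ 1) ^ (m - r) * (N ^ r) ^ (n - r) +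
    N ^ (r * r) * (2 ^ r * N ^ 2) ^ (m - r) * (N ^ (r - 2) * T3) ^ (n - r) +
    N ^ (r * r) * (2 ^ r * N ^ r) ^ (m - r) * (N ^ (r - 3) * E) ^ (n - r))))%N.
Proof.
move=> pp m_gt0 Hp deg fE hT3 EN; rewrite /rank_count; set S := [set x | _].
have iota_inj := box_intr_inj pp Hp.
pose g i j (x : 'I_(2 * H).+1) := (f i j).[(box_int x)%:~R].
have g_fib i j v : (#|[set x | g i j x == v]| <= e)%N.
  have /andP[d2 de] := deg i j; apply: leq_trans de.
  by apply: (card_fiber_poly_le iota_inj); apply: leq_trans d2 (leq_pred _).
pose V i j : {set 'F_p} := g i j @: setT.
have V_le i j : (#|V i j| <= N)%N.
  by apply: leq_trans (leq_imset_card _ _) _; rewrite cardsT card_ord EN.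
pose S' := [set M : 'M['F_p]_(m, n) |
  [forall i, forall j, M i j \in V i j] && (\rank M == r)].
apply: leq_trans (_ : #|S'| * e ^ (m * n) <= _)%N.
  pose val_mx (x : 'M['I_(2 * H).+1]_(m, n)) := \matrix_(i, j) g i j (x i j).
  apply: (leq_card_fibers (h := val_mx)) => [x|A _].
    rewrite !inE => ->; rewrite andbT; apply/forallP => i; apply/forallP => j.
    by rewrite mxE imset_f.
  have := @card_ffun_box_le ('I_m * 'I_n)%type _
    (fun ij => [set x | g ij.1 ij.2 x == A ij.1 ij.2]) set0 e.
  rewrite cards0 subn0 card_prod !card_ord => box; apply: leq_trans (box _ _).
  - apply: (leq_card_inj_in (h := fun x : 'M_(m, n) => [ffun ij => x ij.1 ij.2])).
      move=> x; rewrite !inE => /andP[_ /eqP EA]; apply/forallP => ij.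
      by rewrite inE ffunE -EA mxE.
    move=> x x' _ _ /ffunP ex; apply/matrixP => i j.
    by have := ex (i, j); rewrite !ffunE.
  - by move=> ij; rewrite inE.
  - by move=> ij _; apply: g_fib.
rewrite mulnC leq_mul2l; apply/orP; right.
apply: (@card_rank_le _ m n r N V _ V_le T3 E) => //; first by rewrite EN.
  move=> i i1 i2 j a b v a0 b0; apply: hT3.
  have := linear_equation3_count v (g_fib i j) (fE i1 j) (fE i2 j) a0 b0.
  rewrite card_ord; apply: leq_trans; apply: leq_exp2rW.
  apply: (leq_card_preim_in (h := fun x => (g i1 j x.2.1, g i2 j x.2.2))).
  move=> [u1 u2]; rewrite inE /= => /and3P[/imsetP[x _ ->] /imsetP[y _ ->]].
  move=> /imsetP[z _ ez]; exists (z, (x, y)) => //.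
  by rewrite inE; apply/eqP; exact: esym ez.
move=> i i1 i2 i3 j a b c v a0 b0 c0.
apply: leq_trans (linear_equation4_count v (fE i j) (fE i1 j) (fE i2 j) (fE i3 j)
  a0 b0 c0).
apply: (leq_card_preim_in
  (h := fun x => (g i1 j x.2.1, (g i2 j x.2.2.1, g i3 j x.2.2.2)))).
move=> [u1 [u2 u3]]; rewrite inE /= => /and4P[/imsetP[x _ ->] /imsetP[y _ ->]].
move=> /imsetP[w _ ->] /imsetP[z _ ez]; exists (z, (x, (y, w))) => //.
by rewrite inE; apply/eqP; exact: esym ez.
Qed.

Lemma exp_bigmax_le (I : finType) (G : I -> nat) (k X : nat) : (0 < X)%N ->
  (forall i, G i ^ k <= X)%N -> ((\max_i G i) ^ k <= X)%N.
Proof.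
move=> X_gt0 GX; apply: (big_ind (fun x => x ^ k <= X)%N) => //.
  by case: (k) => [|j]; rewrite ?expn0 ?exp0n.
by move=> x y xX yX; case: (leqP x y).
Qed.

Lemma exists_sqrtn (X : nat) :
  exists2 s : nat, (s ^ 2 <= X)%N & forall x : nat, (x ^ 2 <= X)%N -> (x <= s)%N.
Proof.
have ex0 : exists s, (s ^ 2 <= X)%N by exists 0%N.
have bd s : (s ^ 2 <= X)%N -> (s <= X)%N by apply: leq_trans; rewrite -mulnn; nia.
by case: (ex_maxnP ex0 bd) => s sX smax; exists s.
Qed.

(** * Powers of H and the final exponents *)

Section GrowthRates.
Variables (R : realType) (h : R).
Hypothesis h1 : 1 <= h.

Let h_gt0 : 0 < h. Proof. exact: lt_le_trans ltr01 h1. Qed.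

(** The constant is carried explicitly, so that the final one can be seen not to depend on H, p or
    the polynomials. *)
Definition grows_at_most (a : nat) (c alpha : R) : Prop :=
  [/\ 0 <= c & a%:R <= c * h `^ alpha].

Lemma growsM (a b : nat) (c d alpha beta : R) : grows_at_most a c alpha ->
  grows_at_most b d beta -> grows_at_most (a * b) (c * d) (alpha + beta).
Proof.
move=> [c0 ac] [d0 bd]; split; first exact: mulr_ge0.
rewrite natrM powRD; last by rewrite (gt_eqF h_gt0) implybT.
by rewrite mulrACA ler_pM ?ler0n.
Qed.

Lemma growsX (a k : nat) (c alpha : R) : grows_at_most a c alpha ->
  grows_at_most (a ^ k) (c ^+ k) (alpha * k%:R).
Proof.
move=> ga; elim: k => [|k IHk]; first by split => //; rewrite mulr0 powRr0 mulr1.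
rewrite expnS exprS -natr1 mulrDr mulr1 addrC; exact: growsM.
Qed.

Lemma grows_le (a : nat) (c alpha beta : R) : grows_at_most a c alpha ->
  alpha <= beta -> grows_at_most a c beta.
Proof.
move=> [c0 ac] ab; split => //; apply: le_trans ac _.
by rewrite ler_wpM2l // ler_powR.
Qed.

Lemma growsD (a b : nat) (c d alpha : R) : grows_at_most a c alpha ->
  grows_at_most b d alpha -> grows_at_most (a + b) (c + d) alpha.
Proof.
move=> [c0 ac] [d0 bd]; split; first exact: addr_ge0.
by rewrite natrD mulrDl lerD.
Qed.

Lemma grows_const (a : nat) : grows_at_most a a%:R 0.
Proof. by split => //; rewrite powRr0 mulr1. Qed.

Lemma grows_root (a k : nat) (c alpha : R) : (0 < k)%N -> 1 <= c ->
  grows_at_most (a ^ k) c alpha -> grows_at_most a c (alpha / k%:R).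
Proof.
move=> k_gt0 c1 [c0 ac]; split=> //.
rewrite -(@ler_pXn2r _ k) ?nnegrE ?mulr_ge0 ?powR_ge0 //.
rewrite -natrX (le_trans ac) // exprMn ler_pM ?powR_ge0 //.
  by rewrite -{1}(expr1 c) ler_weXn2l.
by rewrite -powR_mulrn ?powR_ge0 // -powRrM divfK // pnatr_eq0 -lt0n.
Qed.

End GrowthRates.

(** Raise the hypothesis to the power C(e + 1, 2) = e(e + 1)/2, the inverse of its exponent. *)
Lemma expn_bin2_le (R : realType) (H p e : nat) : (0 < e)%N ->
  H%:R <= p%:R `^ (2 / (e%:R * (e%:R + 1))) :> R -> (H ^ 'C(e.+1, 2) <= p)%N.
Proof.
move=> e_gt0 Hp; set c := 'C(e.+1, 2).
have e0 : e%:R != 0 :> R by rewrite pnatr_eq0 -lt0n.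
have e10 : e%:R + 1 != 0 :> R by rewrite natr1 pnatr_eq0.
have cE : c%:R * 2 = e%:R * (e%:R + 1) :> R.
  have := mul_bin_diag e.+1 1; rewrite /= bin1 => /(congr1 (fun x => x%:R : R)).
  by rewrite !natrM -natr1 => E; rewrite mulrC -E mulrC.
rewrite -(ler_nat R) natrX -powR_mulrn //.
apply: le_trans (ge0_ler_powR _ _ _ Hp) _; rewrite ?nnegrE ?powR_ge0 //.
rewrite -powRrM (_ : _ * c%:R = 1) ?powRr1 //.
by rewrite mulrAC [2 * _]mulrC cE divff // mulf_neq0.
Qed.

Section Exponents.
Variables (R : realType) (m n r : nat) (d : R).
Hypotheses (hr : (3 <= r)%N) (hrm : (r <= m)%N) (hmn : (m <= n)%N) (d0 : 0 <= d).

(** The slack [n d] pays for the loss H^d in the energy bound, once per column. *)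
Let top : R := m%:R + n%:R * r%:R - r%:R + Gamma R m n r + n%:R * d.

Let G0 : 0 <= Gamma R m n r.
Proof. by rewrite /Gamma le_max lexx. Qed.

Let G1 : m%:R - (n%:R + r%:R) / 2 <= Gamma R m n r.
Proof. by rewrite /Gamma !le_max lexx orbT. Qed.

Let G2 : m%:R * (r%:R - 1) - n%:R - r%:R * (r%:R - 2) <= Gamma R m n r.
Proof. by rewrite /Gamma !le_max lexx !orbT. Qed.

Let nd : 0 <= n%:R * d. Proof. by rewrite mulr_ge0. Qed.
Let rd : 0 <= r%:R * d. Proof. by rewrite mulr_ge0. Qed.

(** The left sides of the three exponent bounds keep the shape in which the growth rules compose
    them. Beyond m + nr - r they contribute in turn the three terms of [Gamma], up to multiples of
    [d]. *)
Lemma exponent1_le : 1 * (r * r)%:R + (0 + 1 * 1%:R) * (m - r)%:R +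
  1 * r%:R * (n - r)%:R <= top.
Proof.
have -> : 1 * (r * r)%:R + (0 + 1 * 1%:R) * (m - r)%:R + 1 * r%:R * (n - r)%:R =
    m%:R + n%:R * r%:R - r%:R :> R.
  by rewrite !natrB ?(leq_trans hrm) // natrM; ring.
by rewrite /top; move: G0 nd; lra.
Qed.

Lemma exponent2_le : 1 * (r * r)%:R + (0 + 1 * 2%:R) * (m - r)%:R +
  (1 * (r - 2)%:R + (1 + 0 + (2 + d)) / 2) * (n - r)%:R <= top.
Proof.
have -> : 1 * (r * r)%:R + (0 + 1 * 2%:R) * (m - r)%:R +
    (1 * (r - 2)%:R + (1 + 0 + (2 + d)) / 2) * (n - r)%:R =
    m%:R + n%:R * r%:R - r%:R + (m%:R - (n%:R + r%:R) / 2) +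
    (n%:R * d - r%:R * d) / 2 :> R.
  rewrite !natrB ?(leq_trans hrm) // ?(leq_trans _ hr) // natrM.
  by field.
by rewrite /top; move: G1 nd rd; lra.
Qed.

Lemma exponent3_le : 1 * (r * r)%:R + (0 + 1 * r%:R) * (m - r)%:R +
  (1 * (r - 3)%:R + (2 + d)) * (n - r)%:R <= top.
Proof.
have -> : 1 * (r * r)%:R + (0 + 1 * r%:R) * (m - r)%:R +
    (1 * (r - 3)%:R + (2 + d)) * (n - r)%:R =
    m%:R + n%:R * r%:R - r%:R + (m%:R * (r%:R - 1) - n%:R - r%:R * (r%:R - 2)) +
    (n%:R * d - r%:R * d) :> R.
  by rewrite !natrB ?(leq_trans hrm) // natrM; ring.
by rewrite /top; move: G2 nd rd; lra.
Qed.

End Exponents.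

(** The o(1) appears as n(e^2 + e)/k with k free, and [C] is uniform in H, p and f. *)
Lemma rank_count_growth (R : realType) (m n r e k : nat) : (3 <= r)%N ->
  (r <= m)%N -> (m <= n)%N -> (2 <= e)%N -> (0 < k)%N ->
  exists2 C : R, 0 <= C & forall (H p : nat) (f : 'M[{poly 'F_p}]_(m, n)),
    (e < H)%N -> prime p ->
    (forall i j, (2 <= (size (f i j)).-1 <= e)%N) ->
    H%:R <= p%:R `^ (2 / (e%:R * (e%:R + 1))) :> R ->
    (rank_count f r H)%:R <= C * H%:R `^ (m%:R + n%:R * r%:R - r%:R +
      Gamma R m n r + n%:R * ((e ^ 2 + e)%:R / k%:R)).
Proof.
move=> hr hrm hmn he k_gt0; have [C hC] := energy_box_le e k.
pose cE : R := C.+1%:R; pose cT : R := 3 * e%:R * cE.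
pose d : R := (e ^ 2 + e)%:R / k%:R.
have d0 : 0 <= d by rewrite divr_ge0.
exists ((e ^ (m * n))%:R * ((m ^ r * n ^ r).+1%:R *
  (3 ^+ (r * r) * ((2 ^ r)%:R * 3 ^+ 1) ^+ (m - r) * (3 ^+ r) ^+ (n - r) +
   3 ^+ (r * r) * ((2 ^ r)%:R * 3 ^+ 2) ^+ (m - r) *
     (3 ^+ (r - 2) * cT) ^+ (n - r) +
   3 ^+ (r * r) * ((2 ^ r)%:R * 3 ^+ r) ^+ (m - r) *
     (3 ^+ (r - 3) * cE) ^+ (n - r)))).
  by rewrite !(mulr_ge0, addr_ge0, exprn_ge0).
move=> H p f eH pp deg Hp0; have e_gt0 : (0 < e)%N by apply: ltnW.
have Hp := expn_bin2_le e_gt0 Hp0.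
have H_gt0 : (0 < H)%N by apply: leq_trans eH.
(* As e >= 2, the hypothesis gives H^3 <= p, hence 2H < p, and the box embeds in the field. *)
have c3 : (3 <= 'C(e.+1, 2))%N by apply: (@leq_bin2l 3 e.+1 2).
have H3p : (H ^ 3 <= p)%N by apply: leq_trans Hp; rewrite leq_pexp2l.
have H2 : (2 < H)%N by apply: leq_ltn_trans eH.
have H2p : (2 * H < p)%N by apply: leq_trans H3p; rewrite !expnS; nia.
have ep : (e < p)%N by apply: leq_trans eH _; lia.
pose E := \max_(ij : 'I_m * 'I_n)
  energy (fun x : 'I_(2 * H).+1 => (f ij.1 ij.2).[(box_int x)%:~R]).
have fE i j : (energy (fun x : 'I_(2 * H).+1 => (f i j).[(box_int x)%:~R]) <= E)%N.
  exact: (leq_bigmax (i, j)).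
have h1 : 1 <= H%:R :> R by rewrite ler1n.
pose N := (2 * H).+1.
have gN : grows_at_most H%:R N (3 : R) 1.
  by split => //; rewrite powRr1 // -natrM ler_nat /N; lia.
have c1 : 1 <= cE by rewrite ler1n.
have gE : grows_at_most H%:R E cE (2 + d).
  have -> : 2 + d = (2 * k + (e ^ 2 + e))%:R / k%:R.
    by rewrite natrD natrM mulrDl mulfK // pnatr_eq0 -lt0n.
  apply: grows_root => //; split => //; rewrite powR_mulrn // -natrX -natrM ler_nat.
  apply: exp_bigmax_le; first by rewrite muln_gt0 expn_gt0 H_gt0.
  move=> ij; apply: leq_trans (hC H p _ H_gt0 pp ep (deg _ _) Hp) _.
  by rewrite leq_mul2r leqnSn orbT.
have [T3 T3X T3max] := exists_sqrtn (N * e * E).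
have gT : grows_at_most H%:R T3 cT ((1 + 0 + (2 + d)) / 2).
  apply: (@grows_root _ _ T3 2) => //.
    rewrite /cT mulr_ege1 // mulr_ege1 ?ler1n //.
  have [c0 XE] := growsM h1 (growsM h1 gN (grows_const H%:R e)) gE.
  by split => //; apply: le_trans XE; rewrite ler_nat.
have gc := grows_const (H%:R : R); have gX := growsX h1; have gM := growsM h1.
(* The composition follows [rank_count_le] factor by factor: 2H + 1 is at most 3H, [E] grows at most
   like H^(2 + d) and [T3] like H^((3 + d)/2). *)
have gtot := gM _ _ _ _ _ _ (gc (e ^ (m * n))%N) (gM _ _ _ _ _ _
  (gc (m ^ r * n ^ r).+1) (growsD (growsD
   (grows_le h1 (gM _ _ _ _ _ _ (gM _ _ _ _ _ _ (gX _ (r * r)%N _ _ gN)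
     (gX _ (m - r)%N _ _ (gM _ _ _ _ _ _ (gc (2 ^ r)%N) (gX _ 1%N _ _ gN))))
     (gX _ (n - r)%N _ _ (gX _ r _ _ gN))) (exponent1_le hrm hmn d0))
   (grows_le h1 (gM _ _ _ _ _ _ (gM _ _ _ _ _ _ (gX _ (r * r)%N _ _ gN)
     (gX _ (m - r)%N _ _ (gM _ _ _ _ _ _ (gc (2 ^ r)%N) (gX _ 2%N _ _ gN))))
     (gX _ (n - r)%N _ _ (gM _ _ _ _ _ _ (gX _ (r - 2)%N _ _ gN) gT)))
     (exponent2_le hr hrm hmn d0)))
   (grows_le h1 (gM _ _ _ _ _ _ (gM _ _ _ _ _ _ (gX _ (r * r)%N _ _ gN)
     (gX _ (m - r)%N _ _ (gM _ _ _ _ _ _ (gc (2 ^ r)%N) (gX _ r _ _ gN))))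
     (gX _ (n - r)%N _ _ (gM _ _ _ _ _ _ (gX _ (r - 3)%N _ _ gN) gE)))
     (exponent3_le hr hrm hmn d0)))).
have [_ le_tot] := gtot; rewrite !add0r in le_tot.
apply: le_trans le_tot; rewrite ler_nat.
apply: rank_count_le => //; first by apply: leq_trans hrm; apply: leq_trans hr.
Qed.

Theorem theorem2p7 (R : realType) (m n r e : nat)
    (hr : (3 <= r)%N) (hrm : (r <= m)%N) (hmn : (m <= n)%N) (he : (2 <= e)%N) :
  forall eps : R, 0 < eps ->
  exists H0 : nat, forall (H p : nat) (f : 'M[{poly 'F_p}]_(m, n)),
    (H0 <= H)%N -> (1 <= H)%N -> prime p ->
    (forall i j, (2 <= (size (f i j)).-1 <= e)%N) ->
    H%:R <= p%:R `^ (2 / (e%:R * (e%:R + 1))) :> R ->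
    (rank_count f r H)%:R <=
      H%:R `^ (m%:R + n%:R * r%:R - r%:R + Gamma R m n r + eps) :> R.
Proof.
move=> eps eps_gt0.
(* Half of [eps] covers the loss n(e^2 + e)/k. *)
pose k := (Num.bound (n%:R * (e ^ 2 + e)%:R * (2 / eps))).+1.
have k_gt0 : (0 < k)%N by [].
have kP : n%:R * ((e ^ 2 + e)%:R / k%:R) <= eps / 2.
  rewrite mulrA ler_pdivrMr ?ltr0n // [leRHS]mulrC -ler_pdivrMr; last by rewrite divr_gt0.
  rewrite invf_div; apply/ltW; apply: lt_le_trans (archi_boundP _) _.
    by rewrite !mulr_ge0 // invr_ge0 ltW.
  by rewrite ler_nat leqnSn.
have [C C0 hC] := rank_count_growth R hr hrm hmn he k_gt0.
(* The other half absorbs the constant: H >= C^(2/eps) gives C <= H^(eps/2). *)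
exists (maxn e.+1 (Num.bound (C `^ (2 / eps)))) => H p f.
rewrite geq_max => /andP[eH CH] H1 pp deg Hp.
apply: le_trans (hC H p f eH pp deg Hp) _.
have h1 : 1 <= H%:R :> R by rewrite ler1n.
have CleH : C <= H%:R `^ (eps / 2).
  have : C `^ (2 / eps) <= H%:R.
    apply/ltW; apply: lt_le_trans (archi_boundP _) _; first exact: powR_ge0.
    by rewrite ler_nat.
  have eps2 : 0 <= eps / 2 by rewrite divr_ge0 // ltW.
  move/(ge0_ler_powR eps2); rewrite !nnegrE powR_ge0 => /(_ isT (ler0n _ _)).
  by rewrite -powRrM mulrA divfK ?(gt_eqF eps_gt0) // divff ?powRr1 // pnatr_eq0.
apply: le_trans (ler_wpM2r (powR_ge0 _ _) CleH) _.
rewrite -powRD; last by rewrite (gt_eqF (lt_le_trans ltr01 h1)) implybT.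
by apply: ler_powR => //; move: kP; lra.
Qed.
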